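(* Let $\mathcal{D}\subseteq\mathbb{Z}_{\geq 0}$ have at least two elements, let $r=\min(\mathcal{D})$ and $p=\gcd\{d_1-d_2\mid d_1,d_2\in\mathcal{D}\}$. Let $m,n$ be integers tending to infinity such that $2m/n$ stays in a fixed compact interval of $]r,\max(\mathcal{D})[$ and $p$ divides $2m-rn$. Then \[ \sum_{G\in\operatorname{MG}^{(\mathcal{D})}_{n,m}}\kappa(G)=\frac{(2m)!}{2^m m!}\,\frac{p}{\sqrt{2\pi n\zeta\phi'(\zeta)}}\,\frac{\operatorname{Set}_{\mathcal{D}}(\zeta)^n}{\zeta^{2m}}\,(1+O(n^{-1})), \] where $\phi(x)=\frac{x\operatorname{Set}_{\mathcal{D}-1}(x)}{\operatorname{Set}_{\mathcal{D}}(x)}$ and $\zeta$ is the unique positive solution of $\phi(\zeta)=\frac{2m}{n}$.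
   Context: A multigraph $G$ on vertex set $\{1,\dots,n\}$ has a multiset $E(G)$ of edges, each an unordered pair $\{v,w\}$ of vertices with possibly $v=w$ (a loop). The degree of a vertex is its number of occurrences in $E(G)$ (a loop contributes $2$). $\operatorname{MG}^{(\mathcal{D})}_{n,m}$ is the set of multigraphs on $\{1,\dots,n\}$ with $m$ edges (with multiplicity) and all degrees in $\mathcal{D}$. An ordering of $G$ is a sequence $((v_1,w_1),\dots,(v_m,w_m))$ of ordered pairs with $\{\{v_i,w_i\}\}=E(G)$ as multisets; $\kappa(G)={\sf orderings}(G)/(2^m m!)$ where ${\sf orderings}(G)$ is the number of orderings. $\operatorname{Set}_{\mathcal{D}}(x)=\sum_{d\in\mathcal{D}}x^d/d!$ and $\mathcal{D}-i=\{d-i\mid d\in\mathcal{D}, d\geq i\}$; $\max(\mathcal{D})=+\infty$ if $\mathcal{D}$ is infinite. The $O(n^{-1})$ is uniform over $2m/n$ in the compact interval. *)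

(* Defs.v *)
From mathcomp Require Import all_boot all_order all_algebra.
From mathcomp Require Import all_classical all_reals all_analysis.

Set Implicit Arguments.
Unset Strict Implicit.
Unset Printing Implicit Defensive.

Import Order.TTheory GRing.Theory Num.Theory.
Import numFieldNormedType.Exports.

Local Open Scope classical_set_scope.
Local Open Scope ring_scope.

(* The unordered pair {v, w}; a loop is a singleton. *)
Definition edge (n : nat) := {e : {set 'I_n} | (0 < #|e| <= 2)%N}.

(* Multigraphs on n vertices with m edges: G e is the multiplicity of e in
   E(G). Bounding multiplicities by m loses nothing and gives a finite type. *)
Definition multigraph (n m : nat) :=
  {G : {ffun edge n -> 'I_m.+1} | (\sum_e (G e : nat) == m)%N}.

Definition mult (n m : nat) (G : multigraph n m) (e : edge n) : nat :=
  val G e.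

(* Occurrences of v in e: a loop at v counts twice. *)
Definition occ (n : nat) (v : 'I_n) (e : edge n) : nat :=
  if v \in val e then (if #|val e| == 1%N then 2 else 1)%N else 0%N.

Definition deg (n m : nat) (G : multigraph n m) (v : 'I_n) : nat :=
  (\sum_e mult G e * occ v e)%N.

Definition degrees_in (D : set nat) (n m : nat) (G : multigraph n m) : bool :=
  [forall v : 'I_n, deg G v \in D].

Definition is_ordering (n m : nat) (G : multigraph n m)
    (s : m.-tuple ('I_n * 'I_n)) : bool :=
  [forall e : edge n,
     count (fun vw : 'I_n * 'I_n => [set vw.1; vw.2]%SET == val e) s
       == mult G e].

Definition orderings (n m : nat) (G : multigraph n m) : nat :=
  #|[pred s : m.-tuple ('I_n * 'I_n) | is_ordering G s]|.

Definition kappa (R : realType) (n m : nat) (G : multigraph n m) : R :=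
  (orderings G)%:R / (2 ^ m * m`!)%:R.

(* Set_D(x), the sum of x^d / d! over d in D. *)
Definition SetD (R : realType) (D : set nat) (x : R) : R :=
  limn (pseries (fun d => (d \in D)%:R / d`!%:R) x).

Definition shiftD (D : set nat) (i : nat) : set nat :=
  [set (d - i)%N | d in [set d | D d /\ (i <= d)%N]].

Definition phi (R : realType) (D : set nat) (x : R) : R :=
  x * SetD (shiftD D 1) x / SetD D x.

Definition is_min (D : set nat) (r : nat) : Prop :=
  D r /\ forall d, D d -> (r <= d)%N.

(* max(D) for nonempty D, equal to +oo when D is infinite. *)
Definition maxD (R : realType) (D : set nat) : \bar R :=
  ereal_sup [set d%:R%:E | d in D].

Definition divides_differences (D : set nat) (k : nat) : Prop :=
  forall d1 d2, D d1 -> D d2 -> (k%:Z %| d1%:Z - d2%:Z)%Z.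

Definition is_gcd_differences (D : set nat) (p : nat) : Prop :=
  divides_differences D p /\
  forall k, divides_differences D k -> (k %| p)%N.

Definition main_term (R : realType) (D : set nat) (p n m : nat) (zeta : R) : R :=
  (2 * m)`!%:R / (2 ^ m * m`!)%:R
  * (p%:R / Num.sqrt (2 * pi * n%:R * zeta * derive1 (@phi R D) zeta))
  * (SetD D zeta ^+ n / zeta ^+ (2 * m)).

(* Main.v *)
(** Orderings of multigraphs with all degrees in D are words of length 2m over
    the vertices whose letter counts lie in D, so the sum of the [kappa G] is
    (2m)!/(2^m m!) times the coefficient of x^(2m) in Set_D(x)^n; this is
    obtained by differentiating products of derivatives of Set_D at 0.

    The coefficient is extracted on the circle of radius zeta: with the
    probability weights q_d = [d in D] zeta^d / (d! Set_D(zeta)), of mean 2m/n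
    and variance zeta phi'(zeta), it is a Fourier integral of the n-th power of
    the characteristic function z of q centered at its mean. Periodicity
    reduces the integral to [-pi/p, pi/p], where |z(t)|^2 <= 1 - c t^2. Comparing
    z with the Gaussian w by z^n = w^n + n w^(n-1) (z - w) + O(n^2 |z - w|^2)
    gives a relative error O(1/n), because Re(z - w) = O(t^4) and
    Im z = O(t^3). All constants are uniform for zeta in a compact interval.
    Only finite sums occur: the series is truncated at B, which costs an error
    [eta] that vanishes as B tends to infinity with n and m fixed. *)

Require Import Defs.
From mathcomp Require Import all_boot all_order all_algebra.
From mathcomp Require Import all_classical all_reals all_analysis.
From mathcomp Require Import complex ring lra zify.

Set Implicit Arguments.
Unset Strict Implicit.
Unset Printing Implicit Defensive.

Import Order.TTheory GRing.Theory Num.Theory.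
Import numFieldNormedType.Exports.
Import ComplexField.Normc.

Local Open Scope classical_set_scope.
Local Open Scope ring_scope.

(** * Counting orderings *)

(** Leibniz rule. Without repetitions in [r], the test [v == u] singles out exactly one factor. *)
Lemma deriv_bigprod (A : comNzRingType) (I : eqType) (r : seq I)
    (F : I -> {poly A}) : uniq r ->
  (\prod_(i <- r) F i)^`() =
  \sum_(u <- r) \prod_(v <- r) (if v == u then (F v)^`() else F v).
Proof.
elim: r => [|i r IHr] /=; first by rewrite !big_nil derivC.
case/andP=> ir ur; rewrite !big_cons derivM IHr // eqxx addrC [RHS]addrC.
congr (_ + _).
  rewrite mulr_sumr [RHS]big_seq [LHS]big_seq; apply: eq_bigr => u ru.
  rewrite big_cons; case: eqP => [iu|//]; by rewrite iu ru in ir.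
congr (_ * _); rewrite [RHS]big_seq [LHS]big_seq; apply: eq_bigr => u ru.
by case: eqP => // ui; rewrite -ui ru in ir.
Qed.

Definition occurrences (T : eqType) (s : seq (T * T)) (v : T) : nat :=
  (\sum_(x <- s) ((x.1 == v) + (x.2 == v)))%N.

Lemma sum_cons_tuple (A : nmodType) (T : finType) (m : nat)
    (F : m.+1.-tuple T -> A) :
  \sum_s F s = \sum_x \sum_(s : m.-tuple T) F (cons_tuple x s).
Proof.
rewrite pair_big (reindex (fun p : T * m.-tuple T => cons_tuple p.1 p.2)) //=.
exists (fun s => (thead s, behead_tuple s)) => [[x s] _|s _] /=.
  by congr (_, _); apply/val_inj.
by apply/val_inj; rewrite /= [in RHS](tuple_eta s).
Qed.

(** Each derivative of the product selects one vertex and raises its order of derivation by one, so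
    two derivatives select the ordered pair at the head of the tuple. The remaining orders,
    evaluated at 0, test the degrees. The offsets [c] record the pairs already selected and make the
    induction on [m] possible; [B] allows [F] to be a truncated series. *)
Lemma sum_indicator_derivn (A : comNzRingType) (P : pred nat) (n m B : nat)
    (F : {poly A}) (c : 'I_n -> nat) :
  (forall k, (k < B)%N -> (F^`(k)).[0] = (P k)%:R) ->
  (forall v, c v + 2 * m < B)%N ->
  \sum_(s : m.-tuple ('I_n * 'I_n)) \prod_v (P (c v + occurrences s v)%N)%:R
  = (\prod_v F^`(c v))^`(2 * m).[0] :> A.
Proof.
move=> HF; elim: m c => [|m IHm] c Hc.
  rewrite (big_pred1 [tuple]) => [|s]; last by rewrite (tuple0 s) /= eqxx.
  rewrite muln0 derivn0 horner_prod; apply: eq_bigr => v _.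
  by rewrite /occurrences big_nil addn0 HF //; have := Hc v; rewrite muln0 addn0.
rewrite sum_cons_tuple.
have dP (g : 'I_n -> nat) : (\prod_v F^`(g v))^`() =
    \sum_u \prod_v F^`(g v + (u == v)).
  rewrite deriv_bigprod ?index_enum_uniq //.
  apply: eq_bigr => u _; apply: eq_bigr => v _; rewrite eq_sym.
  by case: eqP => _; rewrite ?addn0 // addn1 derivnS.
have -> : (2 * m.+1 = (2 * m).+2)%N by lia.
rewrite !derivSn dP linear_sum /=.
under [in RHS]eq_bigr do rewrite dP.
rewrite [in RHS]pair_big linear_sum horner_sum; apply: eq_bigr => -[u w] _ /=.
rewrite -IHm => [|v]; last by have := Hc v; case: eqP; case: eqP; lia.
apply: eq_bigr => s _; apply: eq_bigr => v _.
by rewrite /occurrences /= big_cons /= !addnA.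
Qed.

Lemma edge_of_pair (n : nat) (x : 'I_n * 'I_n) :
  (0 < #|[set x.1; x.2]%SET| <= 2)%N.
Proof. by rewrite cards2; case: eqP. Qed.

Definition pair_edge n (x : 'I_n * 'I_n) : edge n :=
  exist (fun e : {set 'I_n} => (0 < #|e| <= 2)%N) _ (edge_of_pair x).

Lemma occ_pair_edge n (v : 'I_n) (x : 'I_n * 'I_n) :
  occ v (pair_edge x) = ((x.1 == v) + (x.2 == v))%N.
Proof.
rewrite /occ /= !inE cards2 (eq_sym v) (eq_sym v).
case: (eqVneq x.1 x.2) => [->|ne] /=; first by case: eqP.
case: eqVneq => [e|_] /=; last by case: eqP.
by rewrite -e eq_sym (negbTE ne).
Qed.

(** Double counting by the edge underlying each pair. Taking [g] to be [occ v] gives degrees; taking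
    it constant 1 gives the number of edges. *)
Lemma sum_count_edge n (s : seq ('I_n * 'I_n)) (g : edge n -> nat) :
  (\sum_e count (fun x : 'I_n * 'I_n => [set x.1; x.2]%SET == val e) s * g e
   = \sum_(x <- s) g (pair_edge x))%N.
Proof.
elim: s => [|x s IHs]; first by rewrite big_nil big1 // => e _.
rewrite big_cons -IHs (bigD1 (pair_edge x)) //= [in RHS](bigD1 (pair_edge x)) //=.
rewrite eqxx /= mulnDl mul1n addnA; congr (_ + _)%N.
apply: eq_bigr => e ne; case: eqP => [E|//].
by case/eqP: ne; apply/val_inj.
Qed.

Lemma deg_ordering n m (G : multigraph n m) s v :
  is_ordering G s -> deg G v = occurrences s v.
Proof.
move/forallP=> Gs; rewrite /deg /occurrences.
under [RHS]eq_bigr do rewrite -occ_pair_edge.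
rewrite -(sum_count_edge s (occ v)).
by apply: eq_bigr => e _; rewrite (eqP (Gs e)).
Qed.

Lemma tuple_multigraph_subproof n m (s : m.-tuple ('I_n * 'I_n)) :
  (\sum_e ([ffun e : edge n => inord (count
     (fun x : 'I_n * 'I_n => [set x.1; x.2]%SET == val e) s) : 'I_m.+1] e : nat)
     == m)%N.
Proof.
have Hc e : (count (fun x : 'I_n * 'I_n => [set x.1; x.2]%SET == val e) s < m.+1)%N.
  by rewrite ltnS -[X in (_ <= X)%N](size_tuple s) count_size.
under eq_bigr => e _ do rewrite ffunE inordK //.
have := sum_count_edge s (fun=> 1%N); rewrite sum1_size size_tuple => E.
by apply/eqP; rewrite -[RHS]E; apply: eq_bigr => e _; rewrite muln1.
Qed.

Definition tuple_multigraph n m (s : m.-tuple ('I_n * 'I_n)) : multigraph n m :=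
  exist (fun G : {ffun edge n -> 'I_m.+1} => (\sum_e (G e : nat) == m)%N) _
    (tuple_multigraph_subproof s).

Lemma is_orderingE n m (G : multigraph n m) (s : m.-tuple ('I_n * 'I_n)) :
  is_ordering G s = (G == tuple_multigraph s).
Proof.
have Hc e : (count (fun x : 'I_n * 'I_n => [set x.1; x.2]%SET == val e) s < m.+1)%N.
  by rewrite ltnS -[X in (_ <= X)%N](size_tuple s) count_size.
apply/forallP/eqP => [Gs|-> e].
  apply/val_inj/ffunP => e /=; rewrite ffunE; apply: ord_inj.
  by rewrite inordK; [exact/esym/eqP/(Gs e)|exact: Hc].
by rewrite /mult /= ffunE; apply/eqP; rewrite inordK //; exact: Hc.
Qed.

(** After exchanging the sums, each tuple contributes once, since by [is_orderingE] it orders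
    exactly one multigraph. *)
Lemma sum_orderings (D : set nat) n m :
  (\sum_(G : multigraph n m | degrees_in D G) orderings G
   = \sum_(s : m.-tuple ('I_n * 'I_n)) [forall v, occurrences s v \in D])%N.
Proof.
rewrite /orderings; under eq_bigr do rewrite -sum1_card.
rewrite (exchange_big_dep xpredT) //=; apply: eq_bigr => s _.
have H G : degrees_in D G && is_ordering G s =
    (G == tuple_multigraph s) && [forall v, occurrences s v \in D].
  rewrite andbC is_orderingE; case: eqP => // E; congr (_ && _).
  apply: eq_forallb => v; rewrite (@deg_ordering _ _ _ s) //.
  by rewrite is_orderingE; apply/eqP.
under eq_bigl do rewrite inE H.
case: [forall _, _]; last by rewrite big_pred0 // => G; rewrite andbF.
by rewrite (big_pred1 (tuple_multigraph s)) // => G /=; rewrite andbT.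
Qed.

Definition weight (R : realType) (D : set nat) (d : nat) : R :=
  (d \in D)%:R / d`!%:R.

(** The derivative of order [2 * m] at 0 of the n-th power is $(2m)!$ times its coefficient. Any
    truncation beyond [2 * m] gives the same left-hand side, which later allows [B] to grow
    freely. *)
Lemma sum_kappa_coef (R : realType) (D : set nat) (n m B : nat) :
  (2 * m < B)%N ->
  \sum_(G : multigraph n m | degrees_in D G) kappa R G =
  (2 * m)`!%:R / (2 ^ m * m`!)%:R *
  ((\poly_(d < B) weight R D d) ^+ n)`_(2 * m).
Proof.
move=> HB; rewrite /kappa -mulr_suml -natr_sum sum_orderings mulrAC.
congr (_ / _); set F := \poly_(d < B) _.
have HF k : (k < B)%N -> (F^`(k)).[0] = (k \in D)%:R.
  move=> kB; rewrite horner_coef0 coef_derivn addn0 coef_poly kB /weight ffactnn.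
  by rewrite -[_ *+ _]mulr_natr divfK // pnatr_eq0 -lt0n fact_gt0.
have := @sum_indicator_derivn _ (fun k => k \in D) n m B F (fun=> 0%N) HF.
move=> /(_ (fun=> HB)).
rewrite prodr_const card_ord derivn0 horner_coef0 coef_derivn addn0 ffactnn.
rewrite -[_ *+ _]mulr_natr mulrC => <-.
rewrite natr_sum; apply: eq_bigr => s _; under eq_bigr do rewrite add0n.
(* The product of indicators is 1 if all degrees lie in [D], and a single bad vertex makes it 0. *)
case: forallP => [H|H]; first by rewrite big1 // => v _; rewrite H.
have [v Hv] : exists v, occurrences s v \notin D.
  apply/not_existsP => H'; apply: H => v; apply/negPn/negP; exact: H'.
by rewrite (bigD1 v) //= (negbTE Hv) mul0r.
Qed.

(** * Elementary inequalities *)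

(** Mean value theorem. The Taylor bounds below follow from one another through it: the derivative
    of each remainder is the remainder treated just before. *)
Lemma ge0_of_derive (R : realType) (f df : R -> R) :
  (forall x : R, is_derive x 1 f (df x)) -> (forall x, 0 <= x -> 0 <= df x) ->
  0 <= f 0 -> forall x, 0 <= x -> 0 <= f x.
Proof.
move=> fdf df0 f0 x x0.
have cf : {within `[0, x], continuous f}.
  apply: continuous_subspaceT => y; apply: differentiable_continuous.
  by apply/derivable1_diffP; have [] := fdf y.
have [c] := MVT_segment x0 (fun y _ => fdf y) cf.
rewrite in_itv /= => /andP[c0 _] E.
have := mulr_ge0 (df0 _ c0) x0; rewrite -[X in _ * X]subr0 -E; lra.
Qed.

Lemma is_derive_monomial (R : realType) (n : nat) (c x : R) :
  is_derive x 1 (id ^+ n * cst c : R -> R) (n%:R * x ^+ n.-1 * c).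
Proof.
have := is_deriveM (is_deriveX n (is_derive_id x 1)) (is_derive_cst c x 1).
by move/is_derive_eq; apply; rewrite /GRing.scale /=; ring.
Qed.

Section trigonometric_bounds.
Context {R : realType}.
Implicit Types x : R.

Lemma sin_le_id x : 0 <= x -> sin x <= x.
Proof.
move=> x0; rewrite -subr_ge0.
apply: (@ge0_of_derive R (id - @sin R) (fun x => 1 - cos x)) => //.
by rewrite !fctE sin0 subr0.
Qed.

Lemma cos_ge_taylor2 x : 1 - x ^+ 2 / 2 <= cos x.
Proof.
wlog x0 : x / 0 <= x => [H|].
  by have [/H//|/ltW x0] := leP 0 x; rewrite -sqrrN -cosN; apply: H; lra.
rewrite -subr_ge0.
suff : 0 <= (@cos R - cst 1 + (id ^+ 2 * cst 2^-1)) x.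
  by rewrite !fctE => h; apply: (le_trans h); lra.
have D (y : R) : is_derive y 1 (@cos R - cst 1 + (id ^+ 2 * cst 2^-1))
    ((fun x => x - sin x) y).
  have := is_deriveD (is_deriveB (is_derive_cos y) (is_derive_cst (1 : R) y 1))
    (is_derive_monomial 2 2^-1 y).
  by move/is_derive_eq; apply; rewrite /=; field.
apply: (ge0_of_derive D) => [y y0||//].
- by rewrite subr_ge0 sin_le_id.
- by rewrite !fctE cos0 expr0n /= mul0r subrr addr0.
Qed.

Lemma sin_ge_taylor3 x : 0 <= x -> x - x ^+ 3 / 6 <= sin x.
Proof.
move=> x0; rewrite -subr_ge0.
suff : 0 <= (@sin R - id + (id ^+ 3 * cst 6^-1)) x.
  by rewrite !fctE => h; apply: (le_trans h); lra.
have D (y : R) : is_derive y 1 (@sin R - id + (id ^+ 3 * cst 6^-1))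
    ((fun x => cos x - (1 - x ^+ 2 / 2)) y).
  have := is_deriveD (is_deriveB (is_derive_sin y) (is_derive_id y 1))
    (is_derive_monomial 3 6^-1 y).
  by move/is_derive_eq; apply; rewrite /=; field.
apply: (ge0_of_derive D) => [y y0||//].
- by rewrite subr_ge0 cos_ge_taylor2.
- by rewrite !fctE sin0 expr0n /= mul0r subrr addr0.
Qed.

Lemma cos_le_taylor4 x : cos x <= 1 - x ^+ 2 / 2 + x ^+ 4 / 24.
Proof.
wlog x0 : x / 0 <= x => [H|].
  have [/H//|/ltW x0] := leP 0 x; rewrite -sqrrN -cosN.
  rewrite (_ : x ^+ 4 = (- x) ^+ 4); last by ring.
  by apply: H; lra.
rewrite -subr_ge0.
suff : 0 <= (cst 1 - @cos R - (id ^+ 2 * cst 2^-1) + (id ^+ 4 * cst 24^-1)) x.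
  by rewrite !fctE => h; apply: (le_trans h); lra.
have D (y : R) : is_derive y 1 (cst 1 - @cos R - (id ^+ 2 * cst 2^-1) + (id ^+ 4 * cst 24^-1))
    ((fun x => sin x - (x - x ^+ 3 / 6)) y).
  have := is_deriveD (is_deriveB (is_deriveB (is_derive_cst (1 : R) y 1) (is_derive_cos y))
    (is_derive_monomial 2 2^-1 y)) (is_derive_monomial 4 24^-1 y).
  by move/is_derive_eq; apply; rewrite /=; field.
apply: (ge0_of_derive D) => [y y0||//].
- by rewrite subr_ge0 sin_ge_taylor3.
- by rewrite !fctE cos0 !expr0n /= !mul0r subrr subr0 addr0.
Qed.

Lemma cos_taylor4 x : `|cos x - (1 - x ^+ 2 / 2)| <= x ^+ 4 / 24.
Proof.
have := cos_le_taylor4 x; have := cos_ge_taylor2 x.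
have : 0 <= x ^+ 4 by rewrite exprn_even_ge0.
by rewrite ler_norml; lra.
Qed.

Lemma sin_taylor3 x : `|sin x - x| <= `|x| ^+ 3 / 6.
Proof.
wlog x0 : x / 0 <= x => [H|].
  have [/H//|/ltW x0] := leP 0 x.
  have -> : `|sin x - x| = `|sin (- x) - - x| by rewrite sinN -normrN; congr `|_|; ring.
  by rewrite -(normrN x); apply: H; lra.
have := sin_le_id x0; have := sin_ge_taylor3 x0.
have : 0 <= x ^+ 3 by rewrite exprn_ge0.
by rewrite (ger0_norm x0) ler_norml; lra.
Qed.

Lemma expRN_taylor2 x : 0 <= x -> `|expR (- x) - (1 - x)| <= x ^+ 2 / 2.
Proof.
move=> x0; have h1 := expR_ge1Dx (- x).
have : 0 <= (cst 1 - id + (id ^+ 2 * cst 2^-1) - (@expR R \o -%R)) x.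
  have D (y : R) : is_derive y 1 (cst 1 - id + (id ^+ 2 * cst 2^-1) - (@expR R \o -%R))
      ((fun x => expR (- x) - (1 - x)) y).
    have := is_deriveB (is_deriveD (is_deriveB (is_derive_cst (1 : R) y 1)
    (is_derive_id y 1)) (is_derive_monomial 2 2^-1 y))
    (is_derive1_comp (is_derive_expR (- y)) (is_deriveNid y 1)).
    by move/is_derive_eq; apply; rewrite /=; field.
  apply: (ge0_of_derive D) => [y y0||//].
  - by have := expR_ge1Dx (- y); lra.
  - by rewrite !fctE /= oppr0 expR0 !expr0n /= mul0r; lra.
rewrite !fctE => h2.
have := sqr_ge0 x; by rewrite ler_norml; lra.
Qed.

(** For positive [k], raise $x/k \le 1 + x/k \le e^{x/k}$ to the power [k]. *)
Lemma pow_le_expR k x : 0 <= x -> x ^+ k <= k%:R ^+ k * expR x.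
Proof.
move=> x0; case: k => [|k]; first by rewrite !expr0 mul1r -expR0 ler_expR.
have k0 : 0 < k.+1%:R :> R by [].
have -> : x ^+ k.+1 = k.+1%:R ^+ k.+1 * (x / k.+1%:R) ^+ k.+1.
  by rewrite -exprMn mulrC divfK ?gt_eqF.
rewrite ler_pM2l ?exprn_gt0 //.
have {2}-> : x = k.+1%:R * (x / k.+1%:R) by rewrite mulrC divfK ?gt_eqF.
rewrite expRM_natl; apply: lerXn2r; rewrite ?nnegrE ?expR_ge0 ?divr_ge0 //.
by apply: le_trans (expR_ge1Dx _); rewrite lerDr.
Qed.

Lemma sin_ge_third x : 0 <= x <= 2 -> x / 3 <= sin x.
Proof.
move=> /andP[x0 x2]; apply: le_trans (sin_ge_taylor3 x0).
by rewrite exprSr; nra.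
Qed.

Lemma pi_le4 : pi <= 4 :> R.
Proof. by have := @pihalf_lt2 R; lra. Qed.

End trigonometric_bounds.

(** * Characteristic functions of finite weights *)

Section complex.
Context {R : realType}.
Implicit Types (z w : R[i]) (t : R).

Definition cis t : R[i] := Complex (cos t) (sin t).

Lemma cisD s t : cis (s + t) = cis s * cis t.
Proof. by rewrite /cis cosD sinD; simpc; congr (Complex _ _); ring. Qed.

Lemma cis0 : cis 0 = 1.
Proof. by rewrite /cis cos0 sin0. Qed.

Lemma cisMn n t : cis (n%:R * t) = cis t ^+ n.
Proof.
elim: n => [|n IHn]; first by rewrite mul0r cis0.
by rewrite -natr1 mulrDl mul1r cisD IHn exprSr.
Qed.

Lemma ReD z w : complex.Re (z + w) = complex.Re z + complex.Re w.
Proof. by case: z => ? ?; case: w => ? ?; simpc. Qed.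

Lemma ImD z w : complex.Im (z + w) = complex.Im z + complex.Im w.
Proof. by case: z => ? ?; case: w => ? ?; simpc. Qed.

Lemma ReZ (a : R) z : complex.Re (a%:C%C * z) = a * complex.Re z.
Proof. by case: z => ? ?; simpc. Qed.

Lemma ImZ (a : R) z : complex.Im (a%:C%C * z) = a * complex.Im z.
Proof. by case: z => ? ?; simpc. Qed.

Lemma sqr_normc z : normc z ^+ 2 = complex.Re z ^+ 2 + complex.Im z ^+ 2.
Proof. by case: z => x y; rewrite /= sqr_sqrtr // addr_ge0 // sqr_ge0. Qed.

Lemma normc_ge0 z : 0 <= normc z.
Proof. by case: z => x y; rewrite /= sqrtr_ge0. Qed.

Lemma norm_Re_le z : `|complex.Re z| <= normc z.
Proof.
rewrite -(ger0_norm (normc_ge0 z)) -ler_sqr // ?nnegrE // !real_normK ?num_real //.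
by rewrite sqr_normc lerDl sqr_ge0.
Qed.

(* The recursion is T_(n+1) = z T_n + n w^(n-1) (z - w)^2 for the remainders
   T_n on the left-hand side. *)
Lemma normc_expr_taylor z w (rho : R) n : 0 <= rho ->
  normc z <= rho -> normc w <= rho ->
  normc (z ^+ n.+1 - w ^+ n.+1 - n.+1%:R * w ^+ n * (z - w)) * rho
  <= n.+1%:R ^+ 2 * rho ^+ n * normc (z - w) ^+ 2.
Proof.
move=> rho0 zr wr; elim: n => [|n IHn].
  rewrite !expr1 expr0 mulr1 mul1r subrr normc0 mul0r.
  by rewrite ?mulr_ge0 ?exprn_ge0 ?normc_ge0.
set d := z - w in IHn *.
have -> : z ^+ n.+2 - w ^+ n.+2 - n.+2%:R * w ^+ n.+1 * d =
   z * (z ^+ n.+1 - w ^+ n.+1 - n.+1%:R * w ^+ n * d) + n.+1%:R * w ^+ n * d ^+ 2.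
  by rewrite /d -!natr1 !exprS; ring.
set T := z ^+ n.+1 - _ - _ in IHn *.
have normcX u k : normc (u ^+ k) = normc u ^+ k :> R.
  by elim: k => [|k IHk]; rewrite ?expr0 ?normc1 // !exprS normcM IHk.
have nn : normc (n.+1%:R : R[i]) = n.+1%:R.
  by rewrite -[n.+1%:R]/(1 *+ n.+1) normcMn normc1.
have h1 : normc (z * T + n.+1%:R * w ^+ n * d ^+ 2) <=
   rho * normc T + n.+1%:R * rho ^+ n * normc d ^+ 2.
  apply: (le_trans (le_normcD _ _)); rewrite !normcM nn !normcX; apply: lerD.
    by rewrite ler_wpM2r // normc_ge0.
  rewrite -expr2; apply: ler_wpM2r; first by rewrite exprn_ge0 // normc_ge0.
  by apply: ler_wpM2l => //; apply: lerXn2r; rewrite // nnegrE normc_ge0.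
apply: (le_trans (ler_wpM2r rho0 h1)).
rewrite mulrDl -[rho * normc T * rho]mulrA.
have h2 := ler_wpM2l rho0 IHn; apply: (le_trans (lerD h2 (lexx _))).
have -> : rho * (n.+1%:R ^+ 2 * rho ^+ n * normc d ^+ 2) +
    n.+1%:R * rho ^+ n * normc d ^+ 2 * rho =
   (n.+1%:R ^+ 2 + n.+1%:R) * (rho ^+ n.+1 * normc d ^+ 2) by rewrite (exprS rho); ring.
rewrite -mulrA; apply: ler_wpM2r.
  by rewrite mulr_ge0 ?exprn_ge0 ?normc_ge0.
by rewrite -(natr1 n.+1); have := ler0n R n.+1; nra.
Qed.

Definition charfun (q : nat -> R) (B : nat) (mu t : R) : R[i] :=
  \sum_(d < B) (q d)%:C%C * cis ((d%:R - mu) * t).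

Lemma Re_charfun q B mu t :
  complex.Re (charfun q B mu t) = \sum_(d < B) q d * cos ((d%:R - mu) * t).
Proof.
rewrite /charfun (big_morph _ ReD (erefl : complex.Re (0 : R[i]) = 0)).
by apply: eq_bigr => d _; rewrite ReZ.
Qed.

Lemma Im_charfun q B mu t :
  complex.Im (charfun q B mu t) = \sum_(d < B) q d * sin ((d%:R - mu) * t).
Proof.
rewrite /charfun (big_morph _ ImD (erefl : complex.Im (0 : R[i]) = 0)).
by apply: eq_bigr => d _; rewrite ImZ.
Qed.

(** Centering only multiplies the value of the generating polynomial at $e^{it}$ by $e^{-i\mu t}$,
    so the n-th power is $Q(e^{it})e^{-in\mu t}$. *)
Lemma Re_charfunX q B mu t n : let Q := (\poly_(d < B) q d) ^+ n in
  complex.Re (charfun q B mu t ^+ n) =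
  \sum_(k < size Q) Q`_k * cos ((k%:R - n%:R * mu) * t).
Proof.
move=> Q; pose C : R -> R[i] := real_complex R.
have E (P : {poly R}) s : (map_poly C P).[cis t] * cis s =
    \sum_(k < size P) (P`_k)%:C%C * cis (k%:R * t + s).
  rewrite horner_coef size_map_poly mulr_suml; apply: eq_bigr => k _.
  by rewrite coef_map cisD cisMn mulrA.
have -> : charfun q B mu t = (map_poly C (\poly_(d < B) q d)).[cis t] * cis (- mu * t).
  rewrite (@horner_coef_wide _ B) ?mulr_suml; last first.
    by rewrite (leq_trans (size_poly _ _)) // size_poly.
  apply: eq_bigr => k _; rewrite coef_map coef_poly ltn_ord mulrDl cisD cisMn.
  by rewrite mulrA.
rewrite exprMn -cisMn -horner_exp -rmorphXn /= E.
rewrite (big_morph _ ReD (erefl : complex.Re (0 : R[i]) = 0)).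
by apply: eq_bigr => k _; rewrite ReZ /=; congr (_ * cos _); ring.
Qed.

(** Symmetrization: the squared modulus is $\sum_{d,e} q_d q_e\cos((d-e)t)$, from which [mu] has
    disappeared. With $\cos y = 1 - 2\sin^2(y/2)$ all the subtracted terms are nonnegative, and only
    those with $e = r$ are kept. *)
Lemma sqr_normc_charfun_le (q : nat -> R) B mu t (r : 'I_B) : (forall d, 0 <= q d) ->
  \sum_(d < B) q d <= 1 ->
  normc (charfun q B mu t) ^+ 2 <=
  1 - 2 * q r * \sum_(d < B) q d * sin ((d%:R - r%:R) * t / 2) ^+ 2.
Proof.
move=> q0 q1; rewrite sqr_normc Re_charfun Im_charfun.
have -> : (\sum_(d < B) q d * cos ((d%:R - mu) * t)) ^+ 2 +
    (\sum_(d < B) q d * sin ((d%:R - mu) * t)) ^+ 2 =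
    \sum_(d < B) \sum_(e < B) q d * q e *
      (1 - 2 * sin ((d%:R - e%:R) * t / 2) ^+ 2).
  rewrite !expr2 !big_distrlr /= -big_split; apply: eq_bigr => d _.
  rewrite -big_split; apply: eq_bigr => e _ /=.
  have -> : 1 - 2 * sin ((d%:R - e%:R) * t / 2) ^+ 2 = cos ((d%:R - e%:R) * t).
    set y := (d%:R - e%:R) * t / 2.
    have -> : (d%:R - e%:R) * t = y + y by rewrite /y; field.
    rewrite cosD.
    by have := cos2Dsin2 y; rewrite -!expr2; lra.
  have -> : (d%:R - e%:R) * t = (d%:R - mu) * t - (e%:R - mu) * t by ring.
  by rewrite cosB; ring.
rewrite [leLHS](_ : _ = (\sum_(d < B) q d) ^+ 2 -
   2 * \sum_(d < B) \sum_(e < B) q d * q e * sin ((d%:R - e%:R) * t / 2) ^+ 2).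
  have s0 : 0 <= \sum_(d < B) q d by rewrite sumr_ge0.
  have h : \sum_(d < B) q d * q r * sin ((d%:R - r%:R) * t / 2) ^+ 2 <=
    \sum_(d < B) \sum_(e < B) q d * q e * sin ((d%:R - e%:R) * t / 2) ^+ 2.
    apply: ler_sum => d _; rewrite (bigD1 r) //= lerDl sumr_ge0 // => e _.
    by rewrite mulr_ge0 ?sqr_ge0 // mulr_ge0.
  rewrite [X in _ <= 1 - X](_ : _ =
    2 * \sum_(d < B) q d * q r * sin ((d%:R - r%:R) * t / 2) ^+ 2); last first.
    by rewrite -mulrA !mulr_sumr; apply: eq_bigr => d _; ring.
  by nra.
rewrite !expr2 big_distrlr /= mulr_sumr -sumrB; apply: eq_bigr => d _.
by rewrite mulr_sumr -sumrB; apply: eq_bigr => e _; ring.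
Qed.

End complex.

(** * Gaussian approximation of characteristic functions and of their powers *)

Section gaussian_approximation.
Context {R : realType}.
Implicit Types (q : nat -> R) (mu s eta t : R).

(* [eta] measures how far the truncated weights are from being a probability
   distribution with mean [mu] and variance [s]. *)
Definition nearly_centered q B mu s eta :=
  [/\ \sum_(d < B) q d <= 1,
      `|\sum_(d < B) q d - 1| <= eta,
      `|\sum_(d < B) q d * (d%:R - mu)| <= eta &
      `|\sum_(d < B) q d * (d%:R - mu) ^+ 2 - s| <= eta].

(** Both sides are compared with $1 - st^2/2$: the cosines through the fourth moment, the
    exponential through its second-order expansion. The total mass costs [eta] and the second moment
    [8 * eta], because $t^2/2 \le 8$. *)
Lemma Re_charfun_gauss q B mu s eta (M t : R) :
  (forall d, 0 <= q d) -> nearly_centered q B mu s eta ->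
  \sum_(d < B) q d * (d%:R - mu) ^+ 4 <= M -> 0 <= s <= M -> `|t| <= 4 ->
  `|complex.Re (charfun q B mu t) - expR (- (s * t ^+ 2 / 2))|
  <= (M / 24 + M ^+ 2 / 8) * t ^+ 4 + 9 * eta.
Proof.
move=> q0 [q1 e0 e1 e2] m4 /andP[s0 sM] t4; rewrite Re_charfun.
have t16 : t ^+ 2 <= 16.
  have -> : 16 = 4 ^+ 2 :> R by ring.
  by rewrite -(real_normK (num_real t)) lerXn2r ?nnegrE.
have x0 : 0 <= s * t ^+ 2 / 2 by have := sqr_ge0 t; nra.
have h1 := expRN_taylor2 x0; set w := expR _ in h1 *.
have h2 : `|\sum_(d < B) q d * cos ((d%:R - mu) * t) -
    \sum_(d < B) q d * (1 - ((d%:R - mu) * t) ^+ 2 / 2)| <= M / 24 * t ^+ 4.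
  rewrite -sumrB; apply: (le_trans (ler_norm_sum _ _ _)).
  apply: (@le_trans _ _ (\sum_(d < B) q d * (d%:R - mu) ^+ 4 * (t ^+ 4 / 24))).
    apply: ler_sum => d _; rewrite -mulrBr normrM (ger0_norm (q0 d)) -mulrA.
    apply: ler_wpM2l => //; apply: (le_trans (cos_taylor4 _)).
    by rewrite exprMn mulrA.
  rewrite -mulr_suml (_ : M / 24 * t ^+ 4 = M * (t ^+ 4 / 24)); last by ring.
  apply: ler_wpM2r => //.
  by rewrite divr_ge0 // exprn_even_ge0.
have E : \sum_(d < B) q d * (1 - ((d%:R - mu) * t) ^+ 2 / 2) =
  \sum_(d < B) q d - t ^+ 2 / 2 * \sum_(d < B) q d * (d%:R - mu) ^+ 2.
  rewrite mulr_sumr -sumrB; apply: eq_bigr => d _; ring.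
rewrite E in h2 => {E}.
set S := \sum_(d < B) q d * cos _ in h2 *.
set S0 := \sum_(d < B) q d in e0 h2 *.
set S2 := \sum_(d < B) q d * (d%:R - mu) ^+ 2 in e2 h2 *.
have h3 : `|t ^+ 2 / 2 * (S2 - s)| <= 8 * eta.
  by rewrite normrM ler_pM // ger0_norm ?divr_ge0 ?sqr_ge0 //; lra.
have h4 : (s * t ^+ 2 / 2) ^+ 2 / 2 <= M ^+ 2 / 8 * t ^+ 4.
  have : s ^+ 2 <= M ^+ 2 by rewrite lerXn2r ?nnegrE // (le_trans s0).
  have := exprn_even_ge0 t (isT : ~~ odd 4); nra.
have -> : S - w = (S - (S0 - t ^+ 2 / 2 * S2)) + (S0 - 1) -
   t ^+ 2 / 2 * (S2 - s) - (w - (1 - s * t ^+ 2 / 2)) by ring.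
apply: (le_trans (ler_normB _ _)).
have := ler_normB (S - (S0 - t ^+ 2 / 2 * S2) + (S0 - 1)) (t ^+ 2 / 2 * (S2 - s)).
have := ler_normD (S - (S0 - t ^+ 2 / 2 * S2)) (S0 - 1).
move: h1 h2 h3 h4 e0; lra.
Qed.

(** The linear term of the sine sees only the centered mean, at most [eta] in absolute value. The
    cubic remainder needs a third absolute moment, bounded by means of $|y|^3 \le 1 + y^4$. *)
Lemma Im_charfun_small q B mu s eta (M t : R) :
  (forall d, 0 <= q d) -> nearly_centered q B mu s eta ->
  \sum_(d < B) q d * (d%:R - mu) ^+ 4 <= M -> `|t| <= 4 ->
  `|complex.Im (charfun q B mu t)| <= (1 + M) / 6 * `|t| ^+ 3 + 4 * eta.
Proof.
move=> q0 [q1 e0 e1 e2] m4 t4; rewrite Im_charfun.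
have h1 : `|\sum_(d < B) q d * sin ((d%:R - mu) * t) -
    \sum_(d < B) q d * ((d%:R - mu) * t)| <= (1 + M) / 6 * `|t| ^+ 3.
  rewrite -sumrB; apply: (le_trans (ler_norm_sum _ _ _)).
  apply: (@le_trans _ _ (\sum_(d < B) (q d + q d * (d%:R - mu) ^+ 4) * (`|t| ^+ 3 / 6))).
    apply: ler_sum => d _; rewrite -mulrBr normrM (ger0_norm (q0 d)).
    rewrite [leRHS](_ : _ = q d * ((1 + (d%:R - mu) ^+ 4) * (`|t| ^+ 3 / 6)));
      last by ring.
    apply: ler_wpM2l => //; apply: (le_trans (sin_taylor3 _)).
    rewrite normrM exprMn -mulrA; apply: ler_wpM2r.
      by rewrite divr_ge0 // exprn_ge0.
    have -> : (d%:R - mu) ^+ 4 = `|d%:R - mu| ^+ 4.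
      by rewrite [RHS](exprM _ 2 2) (real_normK (num_real _)) -exprM.
    have : 0 <= `|d%:R - mu| by []; set y := `|_| => y0.
    have [y1|y1] := leP y 1.
      by rewrite (le_trans (exprn_ile1 _ y0 y1)) // lerDl exprn_ge0.
    by rewrite (le_trans (ler_weXn2l (ltW y1) (isT : (3 <= 4)%N))) // lerDr.
  rewrite -mulr_suml big_split /=.
  rewrite (_ : (1 + M) / 6 * `|t| ^+ 3 = (1 + M) * (`|t| ^+ 3 / 6)); last by ring.
  by apply: ler_wpM2r; [rewrite divr_ge0 ?exprn_ge0|exact: lerD].
have h2 : `|\sum_(d < B) q d * ((d%:R - mu) * t)| <= 4 * eta.
  under eq_bigr do rewrite mulrA.
  by rewrite -mulr_suml normrM mulrC ler_pM.
set S := \sum_(d < B) q d * sin _ in h1 *.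
have -> : S = (S - \sum_(d < B) q d * ((d%:R - mu) * t)) +
   \sum_(d < B) q d * ((d%:R - mu) * t) by ring.
by apply: (le_trans (ler_normD _ _)); exact: lerD.
Qed.

(** The real part is kept apart because its error is of order $t^4$, whereas the modulus of the
    error is only of order $t^3$, on account of the imaginary part. *)
Lemma charfun_gauss (M : R) : 0 <= M -> exists2 K : R, 0 < K &
  forall q B mu s eta t,
  (forall d, 0 <= q d) -> nearly_centered q B mu s eta ->
  \sum_(d < B) q d * (d%:R - mu) ^+ 4 <= M -> 0 <= s <= M ->
  0 <= eta <= 1 -> `|t| <= 4 ->
  `|complex.Re (charfun q B mu t) - expR (- (s * t ^+ 2 / 2))|
    <= K * (t ^+ 4 + eta) /\
  normc (charfun q B mu t - (expR (- (s * t ^+ 2 / 2)))%:C%C) ^+ 2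
    <= K * (t ^+ 6 + eta).
Proof.
move=> M0; pose A := M / 24 + M ^+ 2 / 8 + 9; pose E := (1 + M) / 6 + 4.
have A9 : 9 <= A by rewrite /A; have := sqr_ge0 M; lra.
have E4 : 4 <= E by rewrite /E; lra.
exists (A + 32 * A ^+ 2 + 2 * E ^+ 2).
  by have := sqr_ge0 A; have := sqr_ge0 E; lra.
move=> q B mu s eta t q0 nc m4 sM /andP[eta0 eta1] t4.
have hR := Re_charfun_gauss q0 nc m4 sM t4.
have hI := Im_charfun_small q0 nc m4 t4.
set w := expR _ in hR *; set z := charfun _ _ _ _ in hR hI *.
have t40 : 0 <= t ^+ 4 by rewrite exprn_even_ge0.
have A20 := sqr_ge0 A; have E20 := sqr_ge0 E; have M20 := sqr_ge0 M.
have hR' : `|complex.Re z - w| <= A * (t ^+ 4 + eta).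
  by apply: (le_trans hR); rewrite /A; nra.
have hI' : `|complex.Im z| <= E * (`|t| ^+ 3 + eta).
  have := exprn_ge0 3 (normr_ge0 t) => t30.
  by apply: (le_trans hI); rewrite /E; nra.
split; first by apply: (le_trans hR'); nra.
have -> : normc (z - w%:C%C) ^+ 2 = (complex.Re z - w) ^+ 2 + complex.Im z ^+ 2.
  by rewrite sqr_normc; case: (z) => x y; simpc.
have sq (x y u : R) : `|x| <= y * u -> x ^+ 2 <= y ^+ 2 * u ^+ 2.
  move=> h; rewrite -exprMn -(real_normK (num_real x)).
  by rewrite lerXn2r ?nnegrE // (le_trans _ h).
have t16 : t ^+ 2 <= 16.
  have -> : 16 = 4 ^+ 2 :> R by ring.
  by rewrite -(real_normK (num_real t)) lerXn2r ?nnegrE.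
have t6 : t ^+ 6 = (`|t| ^+ 3) ^+ 2.
  by rewrite -exprM (exprM `|t| 2 3) real_normK ?num_real // -exprM.
have t8 : (t ^+ 4) ^+ 2 <= 16 * t ^+ 6.
  have -> : (t ^+ 4) ^+ 2 = t ^+ 2 * t ^+ 6 by ring.
  by apply: ler_wpM2r => //; rewrite exprn_even_ge0.
have t60 : 0 <= t ^+ 6 by rewrite exprn_even_ge0.
have b1 : (t ^+ 4 + eta) ^+ 2 <= 32 * (t ^+ 6 + eta).
  by have := sqr_ge0 (t ^+ 4 - eta); nra.
have b2 : (`|t| ^+ 3 + eta) ^+ 2 <= 2 * (t ^+ 6 + eta).
  by rewrite t6; have := sqr_ge0 (`|t| ^+ 3 - eta); nra.
have := ler_wpM2l A20 b1; have := ler_wpM2l E20 b2.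
have := sq _ _ _ hR'; have := sq _ _ _ hI'.
have A0 : 0 <= A by lra.
have := mulr_ge0 A0 (addr_ge0 t60 eta0).
lra.
Qed.

(** Expansion of $z^n$ around $w^n$, where both moduli are at most $\rho = e^{-ct^2/2}$. The linear
    term is of size $nt^4$ and the quadratic one of size $n^2t^6$; multiplied by a Gaussian in
    $t\sqrt n$, each becomes $O(1/n)$. *)
Lemma charfunX_gauss (M c : R) : 0 <= M -> 0 < c -> exists2 K : R, 0 < K &
  forall q B mu s eta t n,
  (forall d, 0 <= q d) -> nearly_centered q B mu s eta ->
  \sum_(d < B) q d * (d%:R - mu) ^+ 4 <= M -> c <= s <= M ->
  0 <= eta <= 1 -> `|t| <= 4 ->
  normc (charfun q B mu t) ^+ 2 <= 1 - c * t ^+ 2 -> (1 < n)%N ->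
  `|complex.Re (charfun q B mu t ^+ n) - expR (- (n%:R * s / 2 * t ^+ 2))|
  <= K / n%:R * expR (- (n%:R * c / 8 * t ^+ 2)) + K * n%:R ^+ 2 * eta.
Proof.
move=> M0 c0; have [K0 K0_gt0 HK] := charfun_gauss M0.
pose L := K0 * expR (8 * c).
have L0 : 0 < L by rewrite mulr_gt0 ?expR_gt0.
have KL : K0 <= L by rewrite ler_peMr ?ltW // expR_gt1; lra.
(* From $x^k e^{-x} \le k^k$ at $x = nct^2/8$, with $k = 2$ and $k = 3$: $16 = 8\cdot 2$ and $24 =
   8\cdot 3$. *)
pose Z := 16 ^+ 2 / c ^+ 2 + 24 ^+ 3 / c ^+ 3.
have Z0 : 0 < Z by rewrite addr_gt0 // divr_gt0 // exprn_gt0 // ltr0n.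
have LZ0 : 0 < L * Z by rewrite mulr_gt0.
exists (L * Z + 2 * L); first by lra.
move=> q B mu s eta t n q0 nc m4 /andP[cs sM] e01 t4 zc n1.
have [] := HK q B mu s eta t q0 nc m4 _ e01 t4.
  by rewrite sM andbT (le_trans _ cs) // ltW.
case/andP: e01 => eta0 eta1.
set z := charfun _ _ _ _ in zc *; set w := expR (- (s * t ^+ 2 / 2)).
move=> hR hN; pose rho := expR (- (c * t ^+ 2 / 2)).
have t20 := sqr_ge0 t.
have rho0 : 0 < rho by rewrite expR_gt0.
have zr : normc z <= rho.
  rewrite -ler_sqr ?nnegrE ?normc_ge0 ?(ltW rho0) //; apply: (le_trans zc).
  rewrite /rho -expRM_natl; apply: le_trans (expR_ge1Dx _) _.
  by rewrite ler_expR; lra.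
have w0 : 0 < w by rewrite expR_gt0.
have wr : w <= rho by rewrite ler_expR lerN2; nra.
have nw : normc (w%:C%C) = w.
  by rewrite /= expr0n /= addr0 sqrtr_sqr ger0_norm // ltW.
case: n n1 => // n; rewrite ltnS => n0.
have wX k : (w%:C%C : R[i]) ^+ k = (w ^+ k)%:C%C by rewrite rmorphXn.
have nC : (n.+1%:R : R[i]) = (n.+1%:R)%:C%C by rewrite rmorph_nat.
have := @normc_expr_taylor R z w%:C%C rho n (ltW rho0) zr; rewrite nw => /(_ wr).
set T := z ^+ n.+1 - _ - _ => hT.
(* Since [w] is real, the linear term involves only the real part of $z - w$, whose error is the
   smaller one. *)
have ET : complex.Re (z ^+ n.+1) - w ^+ n.+1 =
    complex.Re T + n.+1%:R * w ^+ n * (complex.Re z - w).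
  rewrite /T !wX nC -rmorphM /=.
  case: (z ^+ n.+1) => x1 y1; case: (z) => x2 y2; simpc => /=; ring.
have -> : expR (- (n.+1%:R * s / 2 * t ^+ 2)) = w ^+ n.+1.
  by rewrite /w -expRM_natl; congr expR; ring.
rewrite ET; apply: (le_trans (ler_normD _ _)).
set N := n.+1%:R : R in hT *.
have N1 : 2 <= N by rewrite /N (ler_nat _ 2).
have N0 : 0 < N by lra.
set P := rho ^+ n in hT.
have P0 : 0 < P by rewrite exprn_gt0.
have rho1 : rho <= 1.
  rewrite /rho -[leRHS]expR0 ler_expR.
  by have := mulr_ge0 (ltW c0) t20; lra.
have P1 : P <= 1 := exprn_ile1 _ (ltW rho0) rho1.
set u := expR (- (N * c / 8 * t ^+ 2)).
have u0 : 0 < u by rewrite expR_gt0.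
(* This amounts to $(N-1)/2 \ge N/4$, hence $N \ge 2$. One factor [u] absorbs the powers of [t]; the
   other remains in the bound to be integrated. *)
have Pu : P <= u ^+ 2.
  rewrite /P /rho /u -!expRM_natl ler_expR.
  have -> : n%:R = N - 1 by rewrite /N -natr1 addrK.
  have N2 : 0 <= N - 2 by lra.
  by have := mulr_ge0 N2 (mulr_ge0 (ltW c0) t20); lra.
have hT2 : `|complex.Re T| <= N ^+ 2 * P * (L * (t ^+ 6 + eta)).
  apply: (le_trans (norm_Re_le _)); rewrite -(ler_pM2r rho0).
  apply: (le_trans hT).
  have h1 : N ^+ 2 * P * normc (z - w%:C%C) ^+ 2 <= N ^+ 2 * P * (K0 * (t ^+ 6 + eta)).
    by apply: ler_wpM2l => //; rewrite mulr_ge0 ?sqr_ge0 // ltW.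
  apply: (le_trans h1).
  have -> : N ^+ 2 * P * (L * (t ^+ 6 + eta)) * rho =
     N ^+ 2 * P * (K0 * (t ^+ 6 + eta)) * (expR (8 * c) * rho) by rewrite /L; ring.
  apply: ler_peMr.
    have te : 0 <= t ^+ 6 + eta by rewrite addr_ge0 // exprn_even_ge0.
    by rewrite !mulr_ge0 ?sqr_ge0 // ltW.
  rewrite /rho -expRD -[leLHS]expR0 ler_expR.
  have : t ^+ 2 <= 16.
    have -> : 16 = 4 ^+ 2 :> R by ring.
    by rewrite -(real_normK (num_real t)) lerXn2r ?nnegrE.
  by nra.
have hw : `|N * w ^+ n * (complex.Re z - w)| <= N * P * (L * (t ^+ 4 + eta)).
  rewrite !normrM (gtr0_norm N0) (gtr0_norm (exprn_gt0 n w0)).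
  apply: ler_pM => //; first by rewrite mulr_ge0 ?exprn_ge0 ?ltW.
    by apply: (ler_wpM2l (ltW N0)); apply: lerXn2r; rewrite ?nnegrE // ltW.
  apply: (le_trans hR); apply: ler_wpM2r => //.
  by rewrite addr_ge0 // exprn_even_ge0.
apply: (le_trans (lerD hT2 hw)).
have t40 : 0 <= t ^+ 4 by rewrite exprn_even_ge0.
have t60 : 0 <= t ^+ 6 by rewrite exprn_even_ge0.
pose x := N * c / 8 * t ^+ 2.
have x0 : 0 <= x := mulr_ge0 (divr_ge0 (mulr_ge0 (ltW N0) (ltW c0)) (ler0n _ 8)) t20.
have xu k : x ^+ k * u <= k%:R ^+ k.
  rewrite /u -/x expRN ler_pdivrMr ?expR_gt0 //; exact: pow_le_expR.
have a4 : N * t ^+ 4 * u <= 16 ^+ 2 / c ^+ 2 / N.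
  have -> : N * t ^+ 4 * u = 8 ^+ 2 / c ^+ 2 / N * (x ^+ 2 * u).
    by rewrite /x; field; rewrite !gt_eqF.
  have -> : 16 ^+ 2 / c ^+ 2 / N = 8 ^+ 2 / c ^+ 2 / N * 2 ^+ 2 by ring.
  apply: ler_wpM2l; first by rewrite !divr_ge0 ?exprn_ge0 ?ler0n ?ltW.
  exact: xu 2.
have a6 : N ^+ 2 * t ^+ 6 * u <= 24 ^+ 3 / c ^+ 3 / N.
  have -> : N ^+ 2 * t ^+ 6 * u = 8 ^+ 3 / c ^+ 3 / N * (x ^+ 3 * u).
    by rewrite /x; field; rewrite !gt_eqF.
  have -> : 24 ^+ 3 / c ^+ 3 / N = 8 ^+ 3 / c ^+ 3 / N * 3 ^+ 3 by ring.
  apply: ler_wpM2l; first by rewrite !divr_ge0 ?exprn_ge0 ?ler0n ?ltW.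
  exact: xu 3.
have main : P * (N ^+ 2 * t ^+ 6 + N * t ^+ 4) <= Z / N * u.
  apply: (@le_trans _ _ (u ^+ 2 * (N ^+ 2 * t ^+ 6 + N * t ^+ 4))).
    apply: ler_wpM2r => //.
    exact: addr_ge0 (mulr_ge0 (sqr_ge0 N) t60) (mulr_ge0 (ltW N0) t40).
  have -> : u ^+ 2 * (N ^+ 2 * t ^+ 6 + N * t ^+ 4) =
    (N ^+ 2 * t ^+ 6 * u + N * t ^+ 4 * u) * u by ring.
  apply: (ler_wpM2r (ltW u0)).
  rewrite (_ : Z / N = 24 ^+ 3 / c ^+ 3 / N + 16 ^+ 2 / c ^+ 2 / N) ?lerD //.
  by rewrite /Z mulrDl addrC.
have rest : P * (N ^+ 2 + N) * eta <= 2 * N ^+ 2 * eta.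
  apply: ler_wpM2r => //; apply: (@le_trans _ _ (N ^+ 2 + N)); last by nra.
  by apply: ler_piMl => //; exact: addr_ge0 (sqr_ge0 N) (ltW N0).
have -> : N ^+ 2 * P * (L * (t ^+ 6 + eta)) + N * P * (L * (t ^+ 4 + eta)) =
  L * (P * (N ^+ 2 * t ^+ 6 + N * t ^+ 4)) + L * (P * (N ^+ 2 + N) * eta) by ring.
have e1 : 0 <= L / N * u by rewrite mulr_ge0 ?divr_ge0 ?ltW.
have e2 : 0 <= L * Z * N ^+ 2 * eta := mulr_ge0 (mulr_ge0 (ltW LZ0) (sqr_ge0 N)) eta0.
have -> : (L * Z + 2 * L) / N * u + (L * Z + 2 * L) * N ^+ 2 * eta =
  L * (Z / N * u) + 2 * (L / N * u) + (L * Z * N ^+ 2 * eta) +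
  L * (2 * N ^+ 2 * eta) by ring.
have m1 := ler_wpM2l (ltW L0) main; have m2 := ler_wpM2l (ltW L0) rest.
apply: (le_trans (lerD m1 m2)); rewrite lerD2r -addrA lerDl.
by rewrite addr_ge0 // mulr_ge0.
Qed.

End gaussian_approximation.

(** * Integrals *)

Section integrals.
Context {R : realType}.
Local Notation mu := (@lebesgue_measure R).

Lemma gauss_integrable (s : R) : 0 < s ->
  mu.-integrable setT (EFin \o (fun t : R => expR (- (s * t ^+ 2)))) /\
  (\int[mu]_t (expR (- (s * t ^+ 2))))%R = Num.sqrt (pi / s).
Proof.
(* Up to a constant, the integrand is the centered normal density of variance $1/(2s)$. *)
move=> s0; pose sg : R := (Num.sqrt (2 * s))^-1.
have sg2 : sg ^+ 2 = (2 * s)^-1 by rewrite exprVn sqr_sqrtr // mulr_ge0 // ltW.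
have sg0 : sg != 0 by rewrite invr_neq0 // gt_eqF // sqrtr_gt0 mulr_gt0.
have c0 : 0 < Num.sqrt (pi / s) by rewrite sqrtr_gt0 divr_gt0 // pi_gt0.
have E (t : R) : expR (- (s * t ^+ 2)) = Num.sqrt (pi / s) * normal_pdf 0 sg t.
  rewrite normal_pdfE //= /normal_peak /normal_fun sg2 subr0.
  have -> : (2 * s)^-1 * pi *+ 2 = pi / s.
    by rewrite -mulr_natr; field; rewrite gt_eqF.
  rewrite mulVKf ?gt_eqF //; congr expR.
  by rewrite -mulr_natr; field; rewrite gt_eqF.
have I := integrable_normal_pdf 0 sg.
split.
  have := integrableZl measurableT (Num.sqrt (pi / s)) I.
  apply: eq_integrable => // t _ /=.
  by rewrite E EFinM.
under eq_Rintegral do rewrite E.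
by rewrite RintegralZl // /Rintegral integral_normal_pdf mulr1.
Qed.

Lemma continuous_integrable_itv (f : R -> R) (a b : R) : continuous f ->
  mu.-integrable `[a, b] (EFin \o f).
Proof.
move=> cf; apply: continuous_compact_integrable; first exact: segment_compact.
exact: continuous_subspaceT.
Qed.

Lemma lebesgue_measure_symmetric_itv (T : R) : 0 < T ->
  fine (mu `[- T, T]%classic) = 2 * T.
Proof.
move=> T0; rewrite lebesgue_measure_itv /= lte_fin ifT; last by lra.
by rewrite -EFinD /= opprK; ring.
Qed.

(** Extending [g] by 0 turns the comparison into one over the whole line, with a single Gaussian
    majorant covering both the inside error and the tail; [eta] is charged only on the interval. *)
Lemma Rintegral_compare_gauss (g : R -> R) (T s k K eta : R) :
  continuous g -> 0 < T -> 0 < s -> 0 < k ->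
  (forall t, `|t| <= T ->
     `|g t - expR (- (s * t ^+ 2))| <= K * expR (- (k * t ^+ 2)) + eta) ->
  (forall t, T < `|t| ->
     expR (- (s * t ^+ 2)) <= K * expR (- (k * t ^+ 2))) ->
  `|(\int[mu]_(t in `[- T, T]) g t)%R - Num.sqrt (pi / s)|
  <= K * Num.sqrt (pi / k) + eta * (2 * T).
Proof.
move=> cg T0 s0 k0 hin hout.
have [Is Es] := gauss_integrable s0; have [Ik Ek] := gauss_integrable k0.
have mT : measurable (`[- T, T]%classic : set R) by [].
have Ig : mu.-integrable setT (EFin \o (g \_ `[- T, T])).
  by rewrite -restrict_EFin -integrable_mkcond //; exact: continuous_integrable_itv.
have I1 : mu.-integrable setT (EFin \o ((cst eta : R -> R) \_ `[- T, T])).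
  rewrite -restrict_EFin -integrable_mkcond //.
  by apply: continuous_integrable_itv; exact: cst_continuous.
have IK : mu.-integrable setT (EFin \o (fun t : R => K * expR (- (k * t ^+ 2)))).
  by have := integrableZl measurableT K Ik; apply: eq_integrable => // t _ /=.
rewrite Rintegral_mkcond -Es -RintegralB //.
apply: (le_trans (le_normr_Rintegral _ _)) => //.
  have := integrableB measurableT Ig Is; apply: eq_integrable => // t _ /=.
have -> : K * Num.sqrt (pi / k) + eta * (2 * T) =
  (\int[mu]_t (K * expR (- (k * t ^+ 2)) + ((cst eta : R -> R) \_ `[- T, T]) t))%R.
  rewrite RintegralD // RintegralZl // Ek -Rintegral_mkcond Rintegral_cst //.
  by congr (_ + _ * _); rewrite lebesgue_measure_symmetric_itv.
apply: le_Rintegral => //.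
- have := integrable_abse (integrableB measurableT Ig Is).
  by apply: eq_integrable => // t _ /=.
- by have := integrableD measurableT IK I1; apply: eq_integrable => // t _ /=.
move=> t _; rewrite /patch mem_setE in_itv /= -ler_norml.
case: (leP `|t| T) => h; first exact: hin.
(* Outside the interval, both restricted functions take the default value [point], which is 0 in
   [R]. *)
by rewrite (_ : point = 0 :> R) // sub0r normrN ger0_norm ?expR_ge0 // addr0; exact: hout.
Qed.

Lemma is_derive_sin_scale (w t : R) :
  is_derive t 1 (fun t : R => sin (w * t) / w) (w * cos (w * t) / w).
Proof.
have -> : (fun t : R => sin (w * t) / w) =
  (@sin R \o (id ^+ 1 * cst w)) * cst w^-1.
  by apply/funext => u; rewrite !fctE /= mulrC [u * w]mulrC mulrC.
have := is_deriveM (is_derive1_comp (is_derive_sin ((id ^+ 1 * cst w) t))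
  (is_derive_monomial 1 w t)) (is_derive_cst w^-1 t 1).
move/is_derive_eq; apply; rewrite /GRing.scale /= mulr0 add0r.
by rewrite !fctE /= expr1 expr0 [t * w]mulrC; ring.
Qed.

Lemma continuous_cos_scale (w : R) : continuous (fun t : R => cos (w * t)).
Proof.
move=> t; apply: (@continuous_comp _ _ _ (fun t => w * t) (@cos R)).
  exact: mulrl_continuous.
exact: continuous_cos.
Qed.

Lemma Rintegral_cos (w T : R) : 0 < T -> w != 0 ->
  (\int[mu]_(t in `[- T, T]) cos (w * t))%R = 2 * sin (w * T) / w.
Proof.
move=> T0 w0; pose F := fun t : R => sin (w * t) / w.
have cF t : {for t, continuous F}.
  apply: differentiable_continuous; apply/derivable1_diffP.
  by have [] := is_derive_sin_scale w t.
rewrite /Rintegral (@continuous_FTC2 _ _ F).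
- by rewrite /F /= mulrN sinN; field.
- by lra.
- by apply: continuous_subspaceT; exact: continuous_cos_scale.
- split.
  + by move=> t _; have [] := is_derive_sin_scale w t.
  + by apply: cvg_at_right_filter; exact: cF.
  + by apply: cvg_at_left_filter; exact: cF.
- move=> t _; rewrite derive1E; have [_ ->] := is_derive_sin_scale w t.
  by rewrite mulrAC divff // mul1r.
Qed.

Lemma sin_natpi (k : nat) : sin (k%:R * pi) = 0 :> R.
Proof.
elim: k => [|k IHk]; first by rewrite mul0r sin0.
by rewrite -natr1 mulrDl mul1r sinDpi IHk oppr0.
Qed.

(** Orthogonality of cosines. Every frequency $k - N$ with a nonzero coefficient is a multiple of
    [p], so $[-\pi/p, \pi/p]$ is already a union of full periods for it and only $k = N$
    survives. *)
Lemma Rintegral_Re_charfunX (q : nat -> R) (B n N p : nat) (m : R) :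
  let Q := (\poly_(d < B) q d) ^+ n in
  (0 < p)%N -> n%:R * m = N%:R ->
  (forall k, Q`_k != 0 -> (p %| `|k%:Z - N%:Z|)%N) ->
  (\int[mu]_(t in `[- (pi / p%:R), pi / p%:R])
     complex.Re (charfun q B m t ^+ n))%R = 2 * pi / p%:R * Q`_N.
Proof.
move=> Q p0 nm Hp; set T : R := pi / p%:R.
have T0 : 0 < T by rewrite divr_gt0 ?pi_gt0 ?ltr0n.
under eq_Rintegral do rewrite Re_charfunX -/Q nm.
rewrite /Rintegral.
under eq_integral do rewrite -sumEFin.
rewrite integral_sum //; last first.
  move=> k; apply: continuous_integrable_itv => t.
  by apply: cvgM; [exact: cvg_cst|exact: continuous_cos_scale].
have HI k : (\int[mu]_(t in `[(- T)%R, T]) (Q`_k * cos ((k%:R - N%:R) * t))%:E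
    = (if k == N then 2 * T * Q`_N else 0)%:E)%E.
  have Ic : mu.-integrable `[- T, T] (EFin \o (fun t => cos ((k%:R - N%:R) * t))).
    exact/continuous_integrable_itv/continuous_cos_scale.
  have h : (\int[mu]_(t in `[- T, T]) cos ((k%:R - N%:R) * t))%R * Q`_k =
      (if k == N then 2 * T * Q`_N else 0).
    case: eqVneq => [->|kN].
      under eq_Rintegral do rewrite subrr mul0r cos0.
      rewrite Rintegral_cst // mul1r; congr (_ * _).
      exact: lebesgue_measure_symmetric_itv.
    have [->|Qk] := eqVneq Q`_k 0; first by rewrite mulr0.
    have kN0 : k%:R - N%:R != 0 :> R by rewrite subr_eq0 eqr_nat.
    rewrite Rintegral_cos // (_ : sin _ = 0) ?mulr0 ?mul0r //.
    have [j Ej] := dvdnP (Hp k Qk).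
    have Ej' : `|k%:R - N%:R| = j%:R * p%:R :> R.
      by rewrite -natrM -Ej natr_absz intr_norm rmorphB.
    have pT : p%:R * T = pi by rewrite /T mulrC divfK // pnatr_eq0 -lt0n.
    have : sin (`|k%:R - N%:R| * T) = 0 by rewrite Ej' -mulrA pT sin_natpi.
    by case: (ger0P (k%:R - N%:R : R)) => // _; rewrite mulNr sinN => /eqP;
      rewrite oppr_eq0 => /eqP.
  under eq_integral do rewrite EFinM.
  rewrite integralZl // -h mulrC EFinM /Rintegral fineK //.
  exact: integrable_fin_num.
under eq_bigr do rewrite HI.
rewrite sumEFin /= -big_mkcond /=.
(* If [N] lies beyond the size of [Q], no term survives and the coefficient is 0 as well. *)
have [NQ|QN] := ltnP N (size Q).
  rewrite (big_pred1 (Ordinal NQ)) /= => [|k]; first by rewrite /T mulrA.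
  by [].
rewrite big_pred0 => [|k]; first by rewrite nth_default // mulr0.
by apply/eqP => kN; have := ltn_ord k; rewrite kN ltnNge QN.
Qed.

End integrals.

(** * Local limit estimate for coefficients of powers *)

Section local_limit.
Context {R : realType}.

Lemma continuous_Re_charfunX (q : nat -> R) B m n :
  continuous (fun t => complex.Re (charfun q B m t ^+ n)).
Proof.
have -> : (fun t => complex.Re (charfun q B m t ^+ n)) = fun t =>
   \sum_(k < size ((\poly_(d < B) q d) ^+ n))
     ((\poly_(d < B) q d) ^+ n)`_k * cos ((k%:R - n%:R * m) * t).
  by apply/funext => t; rewrite Re_charfunX.
apply: (@continuous_big R _ _ _ _ add_continuous) => k _ t.
by apply: cvgM; [exact: cvg_cst|exact: continuous_cos_scale].
Qed.

Lemma local_limit (M c : R) (p : nat) : 0 <= M -> 0 < c -> (0 < p)%N ->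
  exists2 K : R, 0 < K & forall (q : nat -> R) B m s eta n N,
  (forall d, 0 <= q d) -> nearly_centered q B m s eta ->
  \sum_(d < B) q d * (d%:R - m) ^+ 4 <= M -> c <= s <= M ->
  0 <= eta <= 1 ->
  (forall t, `|t| <= pi / p%:R ->
     normc (charfun q B m t) ^+ 2 <= 1 - c * t ^+ 2) ->
  (1 < n)%N -> n%:R * m = N%:R ->
  (forall k, ((\poly_(d < B) q d) ^+ n)`_k != 0 -> (p %| `|k%:Z - N%:Z|)%N) ->
  `|2 * pi / p%:R * ((\poly_(d < B) q d) ^+ n)`_N
     - Num.sqrt (2 * pi / (n%:R * s))|
  <= K / n%:R * Num.sqrt n%:R^-1 + K * n%:R ^+ 2 * eta.
Proof.
move=> M0 c0 p0; have [K0 K0_gt0 HK] := charfunX_gauss M0 c0.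
set T : R := pi / p%:R.
have T0 : 0 < T by rewrite divr_gt0 ?pi_gt0 ?ltr0n.
have T4 : T <= 4.
  apply: le_trans pi_le4; rewrite ler_pdivrMr ?ltr0n // ler_peMr ?pi_ge0 //.
  by rewrite ler1n.
(* The added constant bounds the tail of the Gaussian beyond [T], where no estimate on the
   characteristic function is used. *)
pose K1 := K0 + 8 / (3 * c * T ^+ 2).
have K01 : K0 <= K1.
  by rewrite lerDl ltW // divr_gt0 // mulr_gt0 ?exprn_gt0 // mulr_gt0.
have K1_gt0 : 0 < K1 by apply: lt_le_trans K01.
pose r8 := Num.sqrt (8 * pi / c).
have r80 : 0 <= r8 by rewrite sqrtr_ge0.
exists (K1 * r8 + 2 * T * K0).
  have h1 : 0 <= K1 * r8 := mulr_ge0 (ltW K1_gt0) r80.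
  have h2 : 0 < 2 * T * K0 := mulr_gt0 (mulr_gt0 (ltr0Sn R 1) T0) K0_gt0.
  by lra.
move=> q B m s eta n N q0 nc m4 /andP[cs sM] e01 dec n1 nm supp.
have n0 : 0 < n%:R :> R by rewrite ltr0n ltnW.
have s0 : 0 < s by apply: lt_le_trans cs.
rewrite -(Rintegral_Re_charfunX p0 nm supp).
have -> : 2 * pi / (n%:R * s) = pi / (n%:R * s / 2) by field; rewrite !gt_eqF.
have [eta0 eta1] := andP e01.
have bnd : `|(\int[lebesgue_measure]_(t in `[- T, T])
     complex.Re (charfun q B m t ^+ n))%R - Num.sqrt (pi / (n%:R * s / 2))|
  <= K1 / n%:R * Num.sqrt (pi / (n%:R * c / 8)) + K0 * n%:R ^+ 2 * eta * (2 * T).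
  apply: Rintegral_compare_gauss => //.
  - exact: continuous_Re_charfunX.
  - by rewrite divr_gt0 // mulr_gt0.
  - by rewrite divr_gt0 // mulr_gt0.
  - move=> t tT.
    have := HK q B m s eta t n q0 nc m4 _ e01 (le_trans tT T4) (dec _ tT) n1.
    rewrite cs sM => /(_ isT) h; apply: (le_trans h); rewrite lerD2r.
    by rewrite ler_wpM2r ?expR_ge0 // ler_wpM2r // invr_ge0 ltW.
  (* Here $1/2 = 3/8 + 1/8$: the part $e^{-x}$ is at most $1/x = O(1/n)$ because $|t| > T$, and the
     other part is the majorant. *)
  - move=> t tT; pose x := 3 * n%:R * c / 8 * t ^+ 2.
    have tT2 : T ^+ 2 <= t ^+ 2.
      rewrite -(real_normK (num_real t)); apply: lerXn2r; rewrite ?nnegrE //.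
        exact: ltW.
      exact: ltW.
    have x1 : 3 * n%:R * c / 8 * T ^+ 2 <= x.
      by rewrite ler_wpM2l // ltW // divr_gt0 // !mulr_gt0.
    have y0 : 0 < 3 * n%:R * c / 8 * T ^+ 2.
      by rewrite mulr_gt0 ?exprn_gt0 // divr_gt0 // !mulr_gt0.
    have x0 : 0 < x by apply: lt_le_trans x1.
    have e1 : expR (- x) <= K1 / n%:R.
      apply: (@le_trans _ _ (3 * n%:R * c / 8 * T ^+ 2)^-1).
        rewrite expRN lef_pV2 ?posrE ?expR_gt0 //; apply: (le_trans x1).
        by have := @pow_le_expR R 1 x (ltW x0); rewrite !expr1 mul1r.
      have -> : (3 * n%:R * c / 8 * T ^+ 2)^-1 = 8 / (3 * c * T ^+ 2) / n%:R.
        by field; rewrite !gt_eqF.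
      by rewrite ler_wpM2r ?invr_ge0 ?(ltW n0) // lerDr ltW.
    apply: (@le_trans _ _ (expR (- x) * expR (- (n%:R * c / 8 * t ^+ 2)))).
      rewrite -expRD ler_expR /x.
      have : 0 <= (s - c) * (n%:R * t ^+ 2).
        by rewrite mulr_ge0 ?subr_ge0 // mulr_ge0 ?sqr_ge0 // ltW.
      by lra.
    by rewrite ler_wpM2r ?expR_ge0.
apply: (le_trans bnd).
have -> : Num.sqrt (pi / (n%:R * c / 8)) = r8 * Num.sqrt n%:R^-1.
  rewrite -sqrtrM ?divr_ge0 ?mulr_ge0 ?pi_ge0 ?(ltW c0) //; congr Num.sqrt.
  by field; rewrite !gt_eqF.
have a0 : 0 <= n%:R^-1 * Num.sqrt n%:R^-1 :> R.
  by rewrite mulr_ge0 ?invr_ge0 ?sqrtr_ge0 // ltW.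
have a1 : 0 <= n%:R ^+ 2 * eta by rewrite mulr_ge0 ?sqr_ge0.
have a2 : 0 <= 2 * T * K0 * (n%:R^-1 * Num.sqrt n%:R^-1).
  exact: mulr_ge0 (ltW (mulr_gt0 (mulr_gt0 (ltr0Sn R 1) T0) K0_gt0)) a0.
have a3 : 0 <= K1 * r8 * (n%:R ^+ 2 * eta).
  by rewrite mulr_ge0 // mulr_ge0 // ltW.
rewrite -subr_ge0; set X := Num.sqrt _ in a0 a2 *.
have -> : (K1 * r8 + 2 * T * K0) / n%:R * X +
  (K1 * r8 + 2 * T * K0) * n%:R ^+ 2 * eta -
  (K1 / n%:R * (r8 * X) + K0 * n%:R ^+ 2 * eta * (2 * T)) =
  2 * T * K0 * (n%:R^-1 * X) + K1 * r8 * (n%:R ^+ 2 * eta) by ring.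
exact: addr_ge0.
Qed.

End local_limit.

(** * Decay of the characteristic function away from 0 *)

Section decay.
Context {R : realType}.

(** Quantitative form of membership of [k] in the group generated by the differences $d - r$: the
    constants do not depend on [t], and only finitely many elements of [D] are involved. *)
Definition sin_dominated (D : set nat) (r k : nat) := exists (K : R) (B : nat),
  0 <= K /\ forall t : R, sin (k%:R * t / 2) ^+ 2 <=
    K * \sum_(d < B) (val d \in D)%:R * sin ((d%:R - r%:R) * t / 2) ^+ 2.

Lemma sum_indicator_widen (D : set nat) (F : nat -> R) (B B' : nat) :
  (forall d, 0 <= F d) -> (B <= B')%N ->
  \sum_(d < B) (val d \in D)%:R * F d <= \sum_(d < B') (val d \in D)%:R * F d.
Proof.
move=> F0 BB'; rewrite -!(big_mkord xpredT (fun d => (d \in D)%:R * F d)).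
rewrite [leRHS](big_cat_nat (n := B)) //= lerDl sumr_ge0 // => d _.
by rewrite mulr_ge0.
Qed.

Lemma sin_dominated_elt (D : set nat) r d : D d -> (r <= d)%N ->
  sin_dominated D r (d - r).
Proof.
move=> Dd rd; exists 1, d.+1; split=> // t; rewrite mul1r.
rewrite (bigD1 ord_max) //= mem_set // mul1r natrB // lerDl sumr_ge0 // => i _.
by rewrite mulr_ge0 ?sqr_ge0.
Qed.

(** The addition formulas give $\sin^2(x \pm y) \le 2(\sin^2 x + \sin^2 y)$. The relations are
    stated in [R] to avoid truncated subtraction. *)
Lemma sin_dominated_comb (D : set nat) r k l j : sin_dominated D r k ->
  sin_dominated D r l ->
  (j%:R = k%:R + l%:R :> R \/ j%:R = k%:R - l%:R :> R) -> sin_dominated D r j.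
Proof.
move=> [K [B [K0 HK]]] [L [B' [L0 HL]]] E.
exists (2 * (K + L)), (maxn B B'); split; first by rewrite mulr_ge0 ?addr_ge0.
move=> t.
have h : sin (j%:R * t / 2) ^+ 2 <=
    2 * (sin (k%:R * t / 2) ^+ 2 + sin (l%:R * t / 2) ^+ 2).
  set x := k%:R * t / 2; set y := l%:R * t / 2.
  have sq2 (u v : R) : `|u| <= 1 -> u ^+ 2 * v ^+ 2 <= v ^+ 2.
    move=> u1; apply: ler_piMl; first exact: sqr_ge0.
    by rewrite -(real_normK (num_real u)) exprn_ile1.
  have c1 z : `|cos z| <= 1 :> R by rewrite ler_norml cos_geN1 cos_le1.
  have h1 := sq2 (cos y) (sin x) (c1 y); have h2 := sq2 (cos x) (sin y) (c1 x).
  case: E => ->.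
    have -> : (k%:R + l%:R) * t / 2 = x + y by rewrite /x /y; ring.
    rewrite sinD; have := sqr_ge0 (sin x * cos y - cos x * sin y); nra.
  have -> : (k%:R - l%:R) * t / 2 = x - y by rewrite /x /y; ring.
  rewrite sinB; have := sqr_ge0 (sin x * cos y + cos x * sin y); nra.
apply: (le_trans h); rewrite -[leRHS]mulrA; apply: ler_wpM2l => //; rewrite mulrDl.
have sq0 d : 0 <= sin ((d%:R - r%:R) * t / 2) ^+ 2 :> R by rewrite sqr_ge0.
apply: lerD; [apply: (le_trans (HK t))|apply: (le_trans (HL t))];
  apply: ler_wpM2l => //;
  apply: (sum_indicator_widen D (F := fun d => sin ((d%:R - r%:R) * t / 2) ^+ 2)) => //.
  exact: leq_maxl.
exact: leq_maxr.
Qed.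

Lemma sin_dominatedM (D : set nat) r k j :
  sin_dominated D r k -> sin_dominated D r (j * k).
Proof.
move=> Hk; elim: j => [|j IHj].
  by apply: (sin_dominated_comb Hk Hk); right; rewrite mul0n subrr.
by apply: (sin_dominated_comb Hk IHj); left; rewrite mulSn natrD.
Qed.

(* The dominated integers form a set closed under addition and subtraction, so
   its least positive element divides every d - r, hence p. *)
Lemma sin_dominated_gcd (D : set nat) r p :
  (exists d1 d2 : nat, [/\ D d1, D d2 & d1 <> d2]) ->
  is_min D r -> is_gcd_differences D p -> (0 < p)%N /\ sin_dominated D r p.
Proof.
move=> [d1 [d2 [Dd1 Dd2 d12]]] [Dr rmin] [pD pmax].
have [d Dd dr] : exists2 d, D d & (0 < d - r)%N.
  have [e|ne] := eqVneq d1 r.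
    by exists d2 => //; rewrite subn_gt0 ltn_neqAle rmin // andbT -e; apply/eqP.
  by exists d1 => //; rewrite subn_gt0 ltn_neqAle rmin // andbT eq_sym.
have p0 : (0 < p)%N.
  case: p pD {pmax} => // pD; have := pD _ _ Dd Dr.
  by rewrite dvd0z subr_eq0 eqz_nat => /eqP E; move: dr; rewrite E subnn.
split=> //.
pose P g := `[< (0 < g)%N /\ sin_dominated D r g >].
have exP : exists g, P g.
  by exists (d - r)%N; apply/asboolP; split=> //; apply: sin_dominated_elt => //; exact: rmin.
case: (ex_minnP exP) => g /asboolP[g0 gS] gmin.
have gdiv k : sin_dominated D r k -> (g %| k)%N.
  move=> kS; have kg : sin_dominated D r (k %% g).
    apply: (sin_dominated_comb kS (sin_dominatedM (k %/ g) gS)); right.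
    by rewrite {2}(divn_eq k g) natrD addrAC subrr add0r.
  rewrite /dvdn -leqn0 leqNgt; apply/negP => h.
  have hP : P (k %% g)%N by apply/asboolP.
  by have := gmin _ hP; rewrite leqNgt ltn_mod g0.
have gr e : D e -> (g%:Z %| e%:Z - r%:Z)%Z.
  move=> De; rewrite subzn ?rmin // dvdzE /=; apply: gdiv.
  by apply: sin_dominated_elt => //; exact: rmin.
have gp : (g %| p)%N.
  apply: pmax => e1 e2 De1 De2.
  have -> : e1%:Z - e2%:Z = (e1%:Z - r%:Z) - (e2%:Z - r%:Z) by ring.
  by rewrite rpredB ?gr.
by case/dvdnP: gp => j ->; exact: sin_dominatedM.
Qed.

(** Combines [sqr_normc_charfun_le] with the domination of $\sin^2(pt/2)$, which is at least
    $(pt/6)^2$ because $|pt/2| \le \pi/2 \le 2$. The order of the quantifiers matters: [B0] depends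
    on [D], [r], [p] only, then [kappa] bounds the weights below [B0], and [c] is uniform over all
    such weights. *)
Lemma charfun_decay (D : set nat) r p :
  (0 < p)%N -> sin_dominated D r p -> D r ->
  exists2 B0 : nat, (r < B0)%N & forall kappa : R, 0 < kappa ->
  exists2 c : R, 0 < c & forall (q : nat -> R) B (m t : R),
  (B0 <= B)%N -> (forall d, 0 <= q d) -> \sum_(d < B) q d <= 1 ->
  (forall d, (d < B0)%N -> D d -> kappa <= q d) ->
  `|t| <= pi / p%:R -> normc (charfun q B m t) ^+ 2 <= 1 - c * t ^+ 2.
Proof.
move=> p0 [K [B1 [K0 HK]]] Dr.
exists (maxn B1 r.+1); first by rewrite leq_max leqnn orbT.
move=> kappa k0.
have K1 : 0 < K + 1 by lra.
have pp : 0 < p%:R :> R by rewrite ltr0n.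
exists (2 * kappa ^+ 2 * (p%:R / 6) ^+ 2 / (K + 1)).
  by rewrite divr_gt0 // !mulr_gt0 // invr_gt0.
move=> q B m t; rewrite geq_max => /andP[B1B rB] q0 q1 qk tT.
have /= := @sqr_normc_charfun_le R q B m t (Ordinal rB) q0 q1.
move=> h; apply: (le_trans h); rewrite lerD2l lerN2.
have qr : kappa <= q r by rewrite qk // leq_max ltnSn orbT.
pose F d : R := sin ((d%:R - r%:R) * t / 2) ^+ 2.
have F0 d : 0 <= F d by rewrite sqr_ge0.
set S := \sum_(d < B1) (val d \in D)%:R * F d.
have S0 : 0 <= S by rewrite sumr_ge0 // => d _; rewrite mulr_ge0.
have hS : kappa * S <= \sum_(d < B) q d * F d.
  apply: (@le_trans _ _ (\sum_(d < B1) q d * F d)).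
    rewrite /S mulr_sumr; apply: ler_sum => d _.
    case: (boolP (val d \in D)) => dD; last by rewrite mul0r mulr0 mulr_ge0.
    by rewrite mul1r ler_wpM2r // qk ?leq_max ?ltn_ord //; exact: set_mem.
  rewrite -!(big_mkord xpredT (fun d => q d * F d)).
  by rewrite [leRHS](big_cat_nat (n := B1)) //= lerDl sumr_ge0 // => d _; rewrite mulr_ge0.
have hsin : (p%:R / 6) ^+ 2 * t ^+ 2 <= (K + 1) * S.
  apply: (@le_trans _ _ (sin (p%:R * t / 2) ^+ 2)); last first.
    by apply: (le_trans (HK t)); rewrite ler_wpM2r // lerDl.
  have tT' : `|p%:R * t / 2| <= 2.
    rewrite !normrM (gtr0_norm pp) (@ger0_norm _ 2^-1) ?invr_ge0 //.
    have : p%:R * `|t| <= pi by rewrite mulrC -ler_pdivlMr.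
    by have := @pi_le4 R; lra.
  have -> : (p%:R / 6) ^+ 2 * t ^+ 2 = (p%:R * t / 2 / 3) ^+ 2 by field.
  move: tT'; set x := p%:R * t / 2 => x2.
  rewrite -(real_normK (num_real (x / 3))) -(real_normK (num_real (sin x))).
  apply: lerXn2r; rewrite ?nnegrE // normrM (@ger0_norm _ 3^-1) ?invr_ge0 //.
  have -> : `|sin x| = `|sin `|x| |.
    by case: (ger0P x) => // _; rewrite sinN normrN.
  apply: le_trans (ler_norm _); apply: sin_ge_third.
  by rewrite normr_ge0.
have h3 : 2 * kappa ^+ 2 * ((p%:R / 6) ^+ 2 * t ^+ 2) <= 2 * kappa ^+ 2 * ((K + 1) * S).
  by rewrite ler_wpM2l // mulr_ge0 ?sqr_ge0.
have -> : 2 * kappa ^+ 2 * (p%:R / 6) ^+ 2 / (K + 1) * t ^+ 2 =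
   2 * kappa ^+ 2 * ((p%:R / 6) ^+ 2 * t ^+ 2) / (K + 1) by ring.
rewrite ler_pdivrMr //; apply: (le_trans h3).
have -> : 2 * kappa ^+ 2 * ((K + 1) * S) = 2 * (kappa * (kappa * S)) * (K + 1) by ring.
apply: ler_wpM2r; first exact: ltW.
rewrite -[leRHS]mulrA; apply: ler_wpM2l => //.
by apply: ler_pM => //; rewrite ?mulr_ge0 // ltW.
Qed.

End decay.

(** * The series Set_D and the saddle point *)

Section saddle_point.
Context {R : realType}.
Implicit Types (D : set nat) (x y : R).

Lemma weight_ge0 D d : 0 <= weight R D d.
Proof. by rewrite divr_ge0. Qed.

Lemma weight_mem D d : D d -> weight R D d = d`!%:R^-1.
Proof. by move=> Dd; rewrite /weight mem_set // mul1r. Qed.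

Lemma weight_le D d : weight R D d <= d`!%:R^-1.
Proof.
rewrite /weight; case: (d \in D); first by rewrite mul1r.
by rewrite mul0r invr_ge0.
Qed.

Lemma weight_term_ge0 D x d : 0 <= x -> 0 <= weight R D d * x ^+ d.
Proof. by move=> x0; rewrite mulr_ge0 ?weight_ge0 // exprn_ge0. Qed.

Lemma pseries_diffs_weight D :
  pseries_diffs (weight R D) = weight R (shiftD D 1).
Proof.
apply/funext => i; rewrite /pseries_diffs /weight.
have -> : (i \in shiftD D 1) = (i.+1 \in D).
  apply/idP/idP => /set_mem.
    by case=> d [Dd d1] <-; rewrite subn1 prednK //; exact/mem_set.
  by move=> Di; apply/mem_set; exists i.+1; rewrite /= ?subn1.
rewrite factS natrM invfM mulrCA; congr (_ * _).
by rewrite mulrA divff ?mul1r // pnatr_eq0.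
Qed.

Lemma cvg_SetD D x : cvgn (pseries (weight R D) x).
Proof.
apply: normed_cvg; apply: (@series_le_cvg _ _ (exp_coeff `|x|)) => //.
- by move=> n /=.
- by move=> n; exact: exp_coeff_ge0.
- move=> n; rewrite /exp_coeff /= normrM (ger0_norm (weight_ge0 _ _)) normrX mulrC.
  by rewrite ler_wpM2l ?exprn_ge0 // weight_le.
exact: is_cvg_series_exp_coeff.
Qed.

Lemma SetD_cvg D x :
  (fun B => \sum_(d < B) weight R D d * x ^+ d) @ \oo --> SetD D x.
Proof.
rewrite (_ : (fun B => _) = pseries (weight R D) x); first exact: cvg_SetD.
by rewrite /pseries seriesEord.
Qed.

Lemma is_derive_SetD D x : is_derive x 1 (@SetD R D) (SetD (shiftD D 1) x).
Proof.
have := @pseries_snd_diffs R (weight R D) (`|x| + 1) x.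
rewrite !pseries_diffs_weight; apply; try exact: cvg_SetD.
by rewrite [ltRHS]ger0_norm ?addr_ge0 // ltrDl.
Qed.

(** The factor [d] turns $1/d!$ into $1/(d-1)!$. Shifting the sequence by one discards the vanishing
    term at $d = 0$. *)
Lemma SetD_cvg1 D x :
  (fun B => \sum_(d < B) weight R D d * x ^+ d * d%:R) @ \oo
  --> x * SetD (shiftD D 1) x.
Proof.
rewrite -cvg_shiftS.
have -> : [sequence \sum_(d < n.+1) weight R D d * x ^+ d * d%:R]_n =
  fun B => x * \sum_(d < B) weight R (shiftD D 1) d * x ^+ d.
  apply/funext => B /=; rewrite big_ord_recl mulr0 add0r mulr_sumr.
  apply: eq_bigr => d _; rewrite -pseries_diffs_weight /pseries_diffs /=.
  by rewrite (_ : bump 0 d = d.+1) // exprS; ring.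
by apply: cvgM; [exact: cvg_cst|exact: SetD_cvg].
Qed.

Lemma SetD_cvg2 D x :
  (fun B => \sum_(d < B) weight R D d * x ^+ d * d%:R ^+ 2) @ \oo
  --> x * (x * SetD (shiftD (shiftD D 1) 1) x + SetD (shiftD D 1) x).
Proof.
rewrite -cvg_shiftS.
have -> : [sequence \sum_(d < n.+1) weight R D d * x ^+ d * d%:R ^+ 2]_n =
  fun B => x * (\sum_(d < B) weight R (shiftD D 1) d * x ^+ d * d%:R +
    \sum_(d < B) weight R (shiftD D 1) d * x ^+ d).
  apply/funext => B /=; rewrite big_ord_recl expr0n mulr0 add0r -big_split mulr_sumr.
  apply: eq_bigr => d _; rewrite -pseries_diffs_weight /pseries_diffs /=.
  by rewrite (_ : bump 0 d = d.+1) // exprS -natr1; ring.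
apply: cvgM; first exact: cvg_cst.
by apply: cvgD; [exact: SetD_cvg1|exact: SetD_cvg].
Qed.

Lemma SetD_ge_partial D x B : 0 <= x ->
  \sum_(d < B) weight R D d * x ^+ d <= SetD D x.
Proof.
move=> x0; have c := @cvg_SetD D x.
rewrite (_ : \sum_(d < B) _ = pseries (weight R D) x B); last first.
  by rewrite /pseries seriesEord.
apply: nondecreasing_cvgn_le => //.
apply/nondecreasing_seqP => n; rewrite /pseries seriesSr lerDl.
exact: weight_term_ge0.
Qed.

Lemma SetD_ge_term D x d : 0 <= x -> weight R D d * x ^+ d <= SetD D x.
Proof.
move=> x0; apply: le_trans (SetD_ge_partial D d.+1 x0).
rewrite big_ord_recr /= lerDr sumr_ge0 // => i _; exact: weight_term_ge0.
Qed.

Lemma SetD_gt0 D x d : D d -> 0 < x -> 0 < SetD D x.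
Proof.
move=> Dd x0; apply: lt_le_trans (SetD_ge_term D d (ltW x0)).
by rewrite weight_mem // mulr_gt0 ?exprn_gt0 // invr_gt0 ltr0n fact_gt0.
Qed.

Lemma SetD_le D x y : 0 <= x -> x <= y -> SetD D x <= SetD D y.
Proof.
move=> x0 xy; apply: (ler_cvg_to (@SetD_cvg D x) (@SetD_cvg D y)).
near=> B; apply: ler_sum => d _; rewrite ler_wpM2l ?weight_ge0 //.
by rewrite lerXn2r ?nnegrE // (le_trans x0).
Unshelve. all: by end_near. Qed.

(** The Boltzmann distribution on [D] with parameter [x]; its mean is [phi D x]. *)
Definition prob D x (d : nat) : R := weight R D d * x ^+ d / SetD D x.

Lemma sum_prob D x B (F : nat -> R) :
  \sum_(d < B) prob D x d * F d =
  (\sum_(d < B) weight R D d * x ^+ d * F d) / SetD D x.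
Proof. by rewrite mulr_suml; apply: eq_bigr => d _; rewrite /prob mulrAC. Qed.

(** Second moment, in the closed form of [SetD_cvg2], minus the squared mean. *)
Definition variance D x : R :=
  x * (x * SetD (shiftD (shiftD D 1) 1) x + SetD (shiftD D 1) x) / SetD D x
  - phi D x ^+ 2.

Section positive.
Variables (D : set nat) (r : nat) (x : R).
Hypotheses (Dr : D r) (x0 : 0 < x).

Let f0 : 0 < SetD D x. Proof. exact: (SetD_gt0 Dr x0). Qed.

Lemma prob_ge0 d : 0 <= prob D x d.
Proof. by rewrite divr_ge0 ?weight_term_ge0 // ltW. Qed.

Lemma sum_prob_le1 B : \sum_(d < B) prob D x d <= 1.
Proof.
have := sum_prob D x B (fun=> 1); under eq_bigr do rewrite mulr1.
move=> ->; rewrite ler_pdivrMr // mul1r.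
under eq_bigr do rewrite mulr1; exact: SetD_ge_partial (ltW x0).
Qed.

Lemma prob_cvg0 : (fun B => \sum_(d < B) prob D x d) @ \oo --> (1 : R).
Proof.
have -> : (fun B => \sum_(d < B) prob D x d) =
  fun B => (\sum_(d < B) weight R D d * x ^+ d) / SetD D x.
  by apply/funext => B; rewrite mulr_suml.
rewrite -[X in _ --> X](@divff _ (SetD D x)) ?gt_eqF //.
by apply: cvgM; [exact: SetD_cvg|exact: cvg_cst].
Qed.

Lemma prob_cvg1 :
  (fun B => \sum_(d < B) prob D x d * (d%:R - phi D x)) @ \oo --> (0 : R).
Proof.
have -> : (fun B => \sum_(d < B) prob D x d * (d%:R - phi D x)) =
  fun B => (\sum_(d < B) weight R D d * x ^+ d * d%:R) / SetD D x -
     (\sum_(d < B) prob D x d) * phi D x.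
  apply/funext => B; rewrite -sum_prob mulr_suml -sumrB.
  by apply: eq_bigr => d _; rewrite mulrBr.
have E : x * SetD (shiftD D 1) x / SetD D x - 1 * phi D x = 0.
  by rewrite mul1r subrr.
rewrite -[X in _ --> X]E.
apply: cvgB; apply: cvgM; try exact: cvg_cst; last exact: prob_cvg0.
exact: SetD_cvg1.
Qed.

Lemma prob_cvg2 :
  (fun B => \sum_(d < B) prob D x d * (d%:R - phi D x) ^+ 2) @ \oo
  --> variance D x.
Proof.
have -> : (fun B => \sum_(d < B) prob D x d * (d%:R - phi D x) ^+ 2) =
  fun B => (\sum_(d < B) weight R D d * x ^+ d * d%:R ^+ 2) / SetD D x -
     ((\sum_(d < B) prob D x d * (d%:R - phi D x)) * (2 * phi D x)
     + (\sum_(d < B) prob D x d) * phi D x ^+ 2).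
  apply/funext => B; rewrite -(sum_prob D x B (fun d => d%:R ^+ 2)) !mulr_suml -big_split -sumrB.
  by apply: eq_bigr => d _ /=; ring.
have E : x * (x * SetD (shiftD (shiftD D 1) 1) x + SetD (shiftD D 1) x) / SetD D x
   - (0 * (2 * phi D x) + 1 * phi D x ^+ 2) = variance D x.
  by rewrite mul0r add0r mul1r.
rewrite -[X in _ --> X]E.
apply: cvgB; first by apply: cvgM; [exact: SetD_cvg2|exact: cvg_cst].
by apply: cvgD; apply: cvgM; try exact: cvg_cst; [exact: prob_cvg1|exact: prob_cvg0].
Qed.

Lemma variance_ge d : prob D x d * (d%:R - phi D x) ^+ 2 <= variance D x.
Proof.
apply: (cvgr_to_ge prob_cvg2); near=> B.
have dB : (d < B)%N by near: B; exists d.+1.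
rewrite (bigD1 (Ordinal dB)) //= lerDl sumr_ge0 // => e _.
by rewrite mulr_ge0 ?prob_ge0 ?sqr_ge0.
Unshelve. all: by end_near. Qed.

(** Applies $y \le 1 + y^2$ to $y = (d - \phi(x))^2$ and passes to the limit. *)
Lemma variance_le (M : R) :
  (forall B, \sum_(d < B) prob D x d * (d%:R - phi D x) ^+ 4 <= M) ->
  variance D x <= 1 + M.
Proof.
move=> H; apply: (cvgr_to_le prob_cvg2); near=> B.
apply: le_trans (lerD (sum_prob_le1 B) (H B)); rewrite -big_split /=.
apply: ler_sum => d _; rewrite -[X in _ <= X + _]mulr1 -mulrDr.
rewrite ler_wpM2l ?prob_ge0 //.
have -> : (d%:R - phi D x) ^+ 4 = ((d%:R - phi D x) ^+ 2) ^+ 2 by rewrite -exprM.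
by set y := _ ^+ 2; have := sqr_ge0 (y - 1); have := sqr_ge0 y; nra.
Unshelve. all: by end_near. Qed.

(** As in any exponential family, the logarithmic derivative $x\,d/dx$ of the mean is the
    variance. *)
Lemma is_derive_phi : is_derive x 1 (@phi R D) (variance D x / x).
Proof.
have -> : @phi R D = (id * @SetD R (shiftD D 1)) * (fun y => (SetD D y)^-1) by [].
have f0' : SetD D x != 0 by rewrite gt_eqF.
have := is_deriveM (is_deriveM (is_derive_id x 1) (is_derive_SetD (shiftD D 1) x))
  (is_deriveV f0' (is_derive_SetD D x)).
move/is_derive_eq; apply; rewrite /GRing.scale /= /variance /phi !fctE.
by field; rewrite f0' gt_eqF.
Qed.

Lemma derive1_phi : x * derive1 (@phi R D) x = variance D x.
Proof.
rewrite derive1E; have [_ ->] := is_derive_phi.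
by rewrite mulrC divfK // gt_eqF.
Qed.

End positive.

Lemma variance_gt0 D d1 d2 x : D d1 -> D d2 -> d1 <> d2 -> 0 < x ->
  0 < variance D x.
Proof.
move=> D1 D2 d12 x0.
(* At most one of two distinct elements equals the mean; the other one gives a positive term. *)
wlog e : d1 d2 D1 D2 d12 / d1%:R != phi D x.
  move=> H; have [e1|] := eqVneq (d1%:R) (phi D x); last exact: H D1 D2 d12.
  apply: (H d2 d1) => //; first by move/esym.
  by rewrite -e1 eqr_nat; apply/eqP => /esym.
apply: lt_le_trans (variance_ge D1 x0 d1).
rewrite mulr_gt0 ?exprn_even_gt0 ?subr_eq0 //= /prob weight_mem //.
by rewrite divr_gt0 ?(SetD_gt0 D1) // mulr_gt0 ?exprn_gt0 // invr_gt0 ltr0n fact_gt0.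
Qed.

Lemma phi_continuous D r x : D r -> 0 < x -> {for x, continuous (@phi R D)}.
Proof.
move=> Dr x0; apply: differentiable_continuous; apply/derivable1_diffP.
by have [] := is_derive_phi Dr x0.
Qed.

Lemma phi_incr D d1 d2 x y : D d1 -> D d2 -> d1 <> d2 -> 0 < x -> x < y ->
  phi D x < phi D y.
Proof.
move=> D1 D2 d12 x0 xy.
have pos z : z \in `]x, y[ -> 0 < z.
  by rewrite in_itv /= => /andP[xz _]; apply: lt_trans xz.
have [||c cxy E] := @MVT R (@phi R D) (fun z => variance D z / z) x y xy.
- by move=> z /pos z0; exact: is_derive_phi D1 z0.
- apply: continuous_in_subspaceT => z; rewrite inE /= in_itv /= => /andP[xz _].
  by apply: (phi_continuous D1); apply: lt_le_trans xz.
rewrite -subr_gt0 E mulr_gt0 ?subr_gt0 // divr_gt0 ?(pos _ cxy) //.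
exact: variance_gt0 D1 D2 d12 (pos _ cxy).
Qed.

(** Near 0, $\phi$ tends to $r$: the terms of degree $r$ cancel in $x\,\mathrm{Set}_{\mathcal D-1} -
    r\,\mathrm{Set}_{\mathcal D}$, which is at most $Fx^{r+1}$ for $x \le 1$, while
    $\mathrm{Set}_{\mathcal D}(x) \ge x^r/r!$. Hence $\phi(x) - r \le F\,r!\,x$. *)
Lemma phi_small D r (a : R) : is_min D r -> r%:R < a ->
  exists2 x, 0 < x <= 1 & phi D x < a.
Proof.
move=> [Dr rmin] ra; pose F : R := SetD (shiftD D 1) 1.
have F0 : 0 <= F by apply: le_trans (SetD_ge_partial _ 0 ler01); rewrite big_ord0.
pose G := F * r`!%:R + 1.
have G0 : 0 < G by rewrite ltr_wpDl // mulr_ge0.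
pose x : R := Num.min 1 ((a - r%:R) / G).
have x0 : 0 < x by rewrite lt_min ltr01 divr_gt0 // subr_gt0.
have x1 : x <= 1 by rewrite ge_min lexx.
have xG : x * G <= a - r%:R by rewrite -ler_pdivlMr // ge_min lexx orbT.
exists x; first by rewrite x0.
have f0 := SetD_gt0 Dr x0.
rewrite /phi ltr_pdivrMr //.
have h1 : x * SetD (shiftD D 1) x - r%:R * SetD D x <= x ^+ r.+1 * F.
  have c1 : (fun B => \sum_(d < B) weight R D d * x ^+ d * d%:R -
      r%:R * \sum_(d < B) weight R D d * x ^+ d) @ \oo -->
      x * SetD (shiftD D 1) x - r%:R * SetD D x.
    apply: cvgB; first exact: SetD_cvg1.
    by apply: cvgM; [exact: cvg_cst|exact: SetD_cvg].
  have c2 : (fun B => x ^+ r.+1 * \sum_(d < B) weight R D d * 1 ^+ d * d%:R) @ \oo -->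
      x ^+ r.+1 * F.
    apply: cvgM; first exact: cvg_cst.
    by have := @SetD_cvg1 D 1; rewrite mul1r.
  apply: (ler_cvg_to c1 c2); near=> B; rewrite !mulr_sumr -sumrB.
  apply: ler_sum => d _; rewrite expr1n mulr1.
  have [dD|dD] := boolP (val d \in D); last by rewrite /weight (negbTE dD) !mul0r !mulr0 subrr.
  have rd : (r <= d)%N by apply: rmin; exact: set_mem.
  have w0 := weight_ge0 D d.
  rewrite [leLHS](_ : _ = weight R D d * (x ^+ d * (d%:R - r%:R))); last by ring.
  rewrite [leRHS](_ : _ = weight R D d * (x ^+ r.+1 * d%:R)); last by ring.
  apply: ler_wpM2l => //.
  move: rd; rewrite leq_eqVlt => /orP[/eqP <-|rd].
    by rewrite subrr mulr0 mulr_ge0 // exprn_ge0 // ltW.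
  apply: ler_pM => //.
  - by rewrite exprn_ge0 // ltW.
  - by rewrite subr_ge0 ler_nat ltnW.
  - by rewrite ler_wiXn2l // ltW.
  - by rewrite gerBl.
have h2 : x ^+ r <= r`!%:R * SetD D x.
  have := SetD_ge_term D r (ltW x0); rewrite weight_mem // mulrC ler_pdivrMr.
    by rewrite mulrC.
  by rewrite ltr0n fact_gt0.
have h3 : x ^+ r.+1 * F <= x * F * r`!%:R * SetD D x.
  rewrite exprS (_ : x * x ^+ r * F = x * F * x ^+ r); last by ring.
  by rewrite -(mulrA (x * F)) ler_wpM2l // mulr_ge0 // ltW.
have h4 : x * F * r`!%:R < a - r%:R by apply: lt_le_trans xG; rewrite /G; lra.
have h5 : x * F * r`!%:R * SetD D x < (a - r%:R) * SetD D x by rewrite ltr_pM2r.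
by lra.
Unshelve. all: by end_near. Qed.

(** In $\sum_d w_d x^d(d-b)$ the term of [d0] is $gx^{d_0}$, the later terms are nonnegative, and
    the earlier ones sum to at least $-bFx^{d_0-1}$ for $x \ge 1$. It suffices that $gx > bF$,
    whence the choice of [x]. *)
Lemma phi_large D d0 (b : R) : D d0 -> 0 <= b -> b < d0%:R ->
  exists2 x, 1 <= x & b < phi D x.
Proof.
move=> Dd0 b0 bd; pose F : R := SetD D 1.
have F0 : 0 < F := SetD_gt0 Dd0 ltr01.
pose g := (d0%:R - b) * weight R D d0.
have w0 : 0 < weight R D d0 by rewrite weight_mem // invr_gt0 ltr0n fact_gt0.
have g0 : 0 < g by rewrite mulr_gt0 // subr_gt0.
pose x := b * F / g + 1.
have x1 : 1 <= x.
  by rewrite lerDr; exact: divr_ge0 (mulr_ge0 b0 (ltW F0)) (ltW g0).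
have x0 : 0 < x by apply: lt_le_trans x1.
exists x => //; have f0 := SetD_gt0 Dd0 x0.
rewrite /phi ltr_pdivlMr // -subr_gt0.
have xg : 0 < g * x - b * F by rewrite /x mulrDr mulr1 [g * _]mulrC divfK ?gt_eqF //; lra.
(* The value 0 contradicts $0 \le b < d_0$. From here on [d0] is the predecessor of the chosen
   element. *)
case: d0 Dd0 bd w0 @g g0 @x x1 x0 f0 xg => [|d0] Dd0 bd w0 g g0 x x1 x0 f0 xg.
  by move: bd; rewrite ltNge b0.
apply: (@lt_le_trans _ _ (x ^+ d0 * (g * x - b * F))); first by rewrite mulr_gt0 ?exprn_gt0.
have c1 : (fun B => \sum_(d < B) weight R D d * x ^+ d * d%:R -
    b * \sum_(d < B) weight R D d * x ^+ d) @ \oo -->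
    x * SetD (shiftD D 1) x - b * SetD D x.
  apply: cvgB; first exact: SetD_cvg1.
  by apply: cvgM; [exact: cvg_cst|exact: SetD_cvg].
apply: (cvgr_to_ge c1); near=> B.
have dB : (d0.+1 < B)%N by near: B; exists d0.+2.
rewrite mulr_sumr -sumrB (bigD1 (Ordinal dB)) //= mulrBr.
have -> : x ^+ d0 * (g * x) = weight R D d0.+1 * x ^+ d0.+1 * d0.+1%:R -
   b * (weight R D d0.+1 * x ^+ d0.+1) by rewrite /g exprS; ring.
rewrite lerD2l.
apply: (@le_trans _ _ (- \sum_(d < B | d != Ordinal dB) x ^+ d0 * b * (weight R D d * 1 ^+ d))).
  rewrite lerN2 -mulr_sumr -mulrA ler_wpM2l ?exprn_ge0 ?(ltW x0) //.
  rewrite ler_wpM2l //; apply: le_trans (SetD_ge_partial D B ler01).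
  by rewrite [leRHS](bigD1 (Ordinal dB)) //= lerDr weight_term_ge0.
rewrite -sumrN; apply: ler_sum => d /eqP dd.
rewrite expr1n mulr1.
have wd := weight_ge0 D d.
rewrite [leLHS](_ : _ = weight R D d * (- (x ^+ d0 * b))); last by ring.
rewrite [leRHS](_ : _ = weight R D d * (x ^+ d * (d%:R - b))); last by ring.
apply: ler_wpM2l => //.
have [dl|dg] := leqP d d0.
  have h : x ^+ d <= x ^+ d0 by rewrite ler_weXn2l.
  have h0 : 0 <= x ^+ d by rewrite exprn_ge0 // ltW.
  have := ler0n R d; have := mulr_ge0 h0 (ler0n R d); nra.
have h0 : 0 <= x ^+ d * (d%:R - b).
  rewrite mulr_ge0 ?exprn_ge0 ?(ltW x0) // subr_ge0 (le_trans (ltW bd)) //.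
  by rewrite ler_nat.
apply: le_trans h0; rewrite oppr_le0 mulr_ge0 // exprn_ge0 // ltW.
Unshelve. all: by end_near. Qed.

(** Intermediate values of $\phi$ between a point below [a] and a point above [b]. The interval of
    solutions is independent of [v], which is the source of all uniformity below. *)
Lemma saddle_point_exists D r d0 (a b : R) : is_min D r -> D d0 ->
  r%:R < a -> a <= b -> b < d0%:R ->
  exists al be : R, [/\ 0 < al, al <= be & forall v, a <= v <= b ->
    exists2 x, al <= x <= be & phi D x = v].
Proof.
move=> rmin Dd0 ra ab bd; have [Dr _] := rmin.
have b0 : 0 <= b by apply: le_trans ab; apply: le_trans (ltW ra).
have [al /andP[al0 al1] pal] := phi_small rmin ra.
have [be be1 pbe] := phi_large Dd0 b0 bd.
have albe : al <= be by apply: le_trans be1.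
exists al, be; split=> // v /andP[av vb].
have [||x] := @IVT R (@phi R D) al be v albe.
- apply: continuous_in_subspaceT => z; rewrite inE /= in_itv /= => /andP[xz _].
  by apply: (phi_continuous Dr); apply: lt_le_trans xz.
- by rewrite ge_min le_max (le_trans (ltW pal) av) (le_trans vb (ltW pbe)) orbT.
by rewrite in_itv /= => xab E; exists x.
Qed.

End saddle_point.

(** * Uniform bounds on the weights *)

(** Here $Q(X) = cP(zX)$, the passage from the weights of [D] to probabilities. *)
Lemma coef_scaled_exprn (A : comNzRingType) (P Q : {poly A}) (z c : A) :
  (forall k, Q`_k = P`_k * z ^+ k * c) ->
  forall n k, (Q ^+ n)`_k = (P ^+ n)`_k * z ^+ k * c ^+ n.
Proof.
move=> HQ; elim=> [|n IHn] k.
  rewrite !expr0 !coef1 mulr1; case: k => [|k] /=; first by rewrite mulr1.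
  by rewrite mul0r.
rewrite !exprS !coefM !mulr_suml; apply: eq_bigr => i _; rewrite HQ IHn.
have -> : z ^+ k = z ^+ i * z ^+ (k - i) by rewrite -exprD subnKC // -ltnS.
by ring.
Qed.

Lemma coef_exprn_support (A : comNzRingType) (P : {poly A}) (r p : nat) :
  (forall k, P`_k != 0 -> (p%:Z %| k%:Z - r%:Z)%Z) ->
  forall n k, (P ^+ n)`_k != 0 -> (p%:Z %| k%:Z - (r * n)%:Z)%Z.
Proof.
move=> HP; elim=> [|n IHn] k.
  rewrite expr0 coef1; case: k => [|k] /=; last by rewrite eqxx.
  by rewrite muln0 subrr dvdz0.
rewrite exprS coefM => /eqP ne.
have [i hi] : exists i : 'I_k.+1, P`_i * (P ^+ n)`_(k - i) != 0.
  apply/not_existsP => H; apply: ne; apply: big1 => i _.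
  by apply/eqP/negPn/negP; exact: H.
have Pi : P`_i != 0 by apply: contraNneq hi => ->; rewrite mul0r.
have Pk : (P ^+ n)`_(k - i) != 0 by apply: contraNneq hi => ->; rewrite mulr0.
have ik : (i <= k)%N by rewrite -ltnS.
have -> : k%:Z - (r * n.+1)%:Z = (i%:Z - r%:Z) + ((k - i)%N%:Z - (r * n)%:Z).
  by rewrite -subzn // mulnS PoszD; ring.
by rewrite rpredD ?HP ?IHn.
Qed.

(** Restricted to $e \le 1$ because the Gaussian estimates require [eta] to be at most 1. *)
Lemma le_of_le_add_eps (R : realType) (u v k : R) : 0 <= k ->
  (forall e, 0 < e <= 1 -> v <= u + k * e) -> v <= u.
Proof.
move=> k0 H; apply/ler_addgt0Pr => e e0.
have k1 : 0 < k + 1 by lra.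
pose e' := Num.min 1 (e / (k + 1)).
have e'0 : 0 < e' by rewrite lt_min ltr01 divr_gt0.
apply: (le_trans (H e' _)); first by rewrite e'0 ge_min lexx.
rewrite lerD2l; apply: (@le_trans _ _ ((k + 1) * e')); first by nra.
by rewrite mulrC -ler_pdivlMr // ge_min lexx orbT.
Qed.

Section prob_bounds.
Context {R : realType} (D : set nat) (r : nat) (al be : R).
Hypotheses (Dr : D r) (al0 : 0 < al) (albe : al <= be).

(** Uses $d! \le B_0!$, $x^d \ge \min(1,\alpha)^{B_0}$ and the monotonicity of
    $\mathrm{Set}_{\mathcal D}$, where $\alpha$ is [al]. *)
Lemma prob_bounded_below (B0 : nat) : exists2 kap : R, 0 < kap &
  forall x d, al <= x <= be -> (d < B0)%N -> D d -> kap <= prob D x d.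
Proof.
pose g : R := Num.min 1 al.
have g0 : 0 < g by rewrite lt_min ltr01.
have be0 : 0 < be by apply: lt_le_trans albe.
have fb0 := SetD_gt0 Dr be0.
have B00 : 0 < B0`!%:R :> R by rewrite ltr0n fact_gt0.
exists (B0`!%:R^-1 * g ^+ B0 / SetD D be).
  by rewrite divr_gt0 // mulr_gt0 ?exprn_gt0 // invr_gt0.
move=> x d /andP[alx xbe] dB Dd.
have x0 : 0 < x by apply: lt_le_trans alx.
have f0 := SetD_gt0 Dr x0.
have d0 : 0 < d`!%:R :> R by rewrite ltr0n fact_gt0.
rewrite /prob weight_mem //; apply: ler_pM.
- by rewrite mulr_ge0 ?invr_ge0 ?exprn_ge0 ?ltW.
- by rewrite invr_ge0 ltW.
- apply: ler_pM; rewrite ?invr_ge0 ?exprn_ge0 ?(ltW g0) ?(ltW B00) //.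
    rewrite lef_pV2 ?posrE // ler_nat; exact/leq_fact/ltnW.
  apply: (@le_trans _ _ (g ^+ d)).
    by rewrite ler_wiXn2l ?(ltW g0) ?ge_min ?lexx // ltnW.
  rewrite lerXn2r ?nnegrE ?(ltW g0) ?(ltW x0) //.
  by apply: le_trans alx; rewrite ge_min lexx orbT.
- by rewrite lef_pV2 ?posrE //; exact: SetD_le (ltW x0) xbe.
Qed.

(** Since $|d - m| \le (1+b)2^d$, the fourth power costs a factor $16^d$, absorbed into the argument
    of the exponential series, which is [SetD setT]. *)
Lemma prob_fourth_moment (b m x : R) B : 0 <= m <= b -> al <= x <= be ->
  \sum_(d < B) prob D x d * (d%:R - m) ^+ 4 <=
  (1 + b) ^+ 4 * SetD setT (16 * be) / SetD D al.
Proof.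
move=> /andP[m0 mb] /andP[alx xbe].
have x0 : 0 < x by apply: lt_le_trans alx.
have be0 : 0 < be by apply: lt_le_trans albe.
have fa0 := SetD_gt0 Dr al0; have f0 := SetD_gt0 Dr x0.
have b0 : 0 <= 1 + b by lra.
apply: (@le_trans _ _ (\sum_(d < B) (weight R setT d * (16 * be) ^+ d) *
  ((1 + b) ^+ 4 / SetD D al))); last first.
  rewrite -mulr_suml mulrC -[leRHS]mulrA [X in _ <= _ * X]mulrC mulrA.
  rewrite ler_wpM2l //; first by rewrite divr_ge0 ?exprn_ge0 // ltW.
  by apply: SetD_ge_partial; rewrite mulr_ge0 // ltW.
apply: ler_sum => d _.
rewrite [leRHS](_ : _ = (weight R setT d * be ^+ d / SetD D al) *
   ((1 + b) * 2 ^+ d) ^+ 4); last first.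
  by rewrite !exprMn -(exprM 2 d 4) mulnC exprM (_ : 2 ^+ 4 = 16 :> R); ring.
apply: ler_pM.
- exact: prob_ge0 Dr x0 d.
- by rewrite exprn_even_ge0.
- rewrite /prob; apply: ler_pM; rewrite ?invr_ge0 ?weight_term_ge0 ?(ltW x0) ?(ltW f0) //.
    apply: ler_pM; rewrite ?weight_ge0 ?exprn_ge0 ?(ltW x0) //.
      by rewrite [leRHS]weight_mem //; exact: weight_le.
    by rewrite lerXn2r ?nnegrE ?(ltW x0) ?(ltW be0).
  by rewrite lef_pV2 ?posrE //; exact: SetD_le (ltW al0) alx.
have d2 : d%:R <= 2 ^+ d :> R by rewrite -natrX ler_nat ltnW // ltn_expl.
have d1 : 1 <= 2 ^+ d :> R by rewrite exprn_ege1 // ler1n.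
have h : `|d%:R - m| <= (1 + b) * 2 ^+ d.
  by have := ler0n R d; rewrite ler_norml; nra.
have -> : (d%:R - m) ^+ 4 = `|d%:R - m| ^+ 4.
  by rewrite [RHS](exprM _ 2 2) (real_normK (num_real _)) -exprM.
by rewrite lerXn2r ?nnegrE // (le_trans _ h).
Qed.

Lemma prob_nearly_centered (x e : R) (B1 : nat) : 0 < x -> 0 < e ->
  exists2 B, (B1 <= B)%N &
  nearly_centered (prob D x) B (phi D x) (variance D x) e.
Proof.
move=> x0 e0.
have /cvgrPdistC_le /(_ e e0) n0 := prob_cvg0 Dr x0.
have /cvgrPdistC_le /(_ e e0) n1 := prob_cvg1 Dr x0.
have /cvgrPdistC_le /(_ e e0) n2 := prob_cvg2 Dr x0.
near \oo => B; exists B; first by near: B; exists B1.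
split; first exact: sum_prob_le1 Dr x0 B.
- by near: B.
- by rewrite -[X in `|X|]subr0; near: B.
- by near: B.
Unshelve. all: by end_near. Qed.

End prob_bounds.

(** * Uniform asymptotics of the weighted number of multigraphs *)

Theorem theorem3 (R : realType) (D : set nat) (r p : nat) (a b : R)
  (D_ge2 : exists d1 d2 : nat, [/\ D d1, D d2 & d1 <> d2])
  (r_min : is_min D r)
  (p_gcd : is_gcd_differences D p)
  (r_lt_a : r%:R < a) (a_le_b : a <= b) (b_lt_max : (b%:E < maxD R D)%E) :
  exists (C : R) (N : nat), forall n m : nat,
    (0 < n)%N ->
    a <= (2 * m)%:R / n%:R <= b ->
    (p%:Z %| (2 * m)%:Z - (r * n)%:Z)%Z ->
    exists zeta : R,
      [/\ 0 < zeta,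
          phi D zeta = (2 * m)%:R / n%:R,
          (forall z : R, 0 < z -> phi D z = (2 * m)%:R / n%:R -> z = zeta)
        & (N <= n)%N -> (N <= m)%N ->
          exists eps : R,
            `|eps| <= C / n%:R /\
            \sum_(G : multigraph n m | degrees_in D G) kappa R G
              = main_term D p n m zeta * (1 + eps)].
Proof.
have [Dr _] := r_min.
have [d1 [d2 [Dd1 Dd2 d12]]] := D_ge2.
have [p0 pdom] := @sin_dominated_gcd R D r p D_ge2 r_min p_gcd.
have [d0 Dd0 bd0] : exists2 d : nat, D d & b < d%:R.
  have [_ [d Dd <-]] := ereal_sup_gt b_lt_max.
  by rewrite lte_fin; exists d.
have [al [be [al0 albe Hz]]] := saddle_point_exists r_min Dd0 r_lt_a a_le_b bd0.
have [B0 rB0 Hdec] := charfun_decay p0 pdom Dr.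
have [kap kap0 Hkap] := prob_bounded_below Dr al0 albe B0.
have [c1 c10 Hc1] := Hdec kap kap0.
have ar0 : 0 < a - r%:R by rewrite subr_gt0.
(* The second argument bounds the variance from below: the term of [r] alone is at least [kap] times
   $(a-r)^2$. *)
pose c := Num.min c1 (kap * (a - r%:R) ^+ 2).
have c0 : 0 < c by rewrite lt_min c10 mulr_gt0 ?exprn_gt0.
pose M0 := (1 + b) ^+ 4 * SetD setT (16 * be) / SetD D al.
have b0 : 0 <= b by apply: le_trans a_le_b; apply: le_trans (ltW r_lt_a).
have M0_ge0 : 0 <= M0.
  have be0 : 0 < 16 * be by rewrite mulr_gt0 //; apply: lt_le_trans albe.
  rewrite divr_ge0 ?mulr_ge0 ?exprn_ge0 ?addr_ge0 //.
    by rewrite ltW // (@SetD_gt0 R setT _ 0).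
  by rewrite ltW // (SetD_gt0 Dr al0).
have M_ge0 : 0 <= 1 + M0 by rewrite addr_ge0.
have M0_le : M0 <= 1 + M0 by rewrite lerDr.
have [K K0 HK] := local_limit M_ge0 c0 p0.
have pi0 := pi_gt0 R.
have tau0 : 0 < 2 * pi :> R by rewrite mulr_gt0.
have pR0 : 0 < p%:R :> R by rewrite ltr0n.
(* The constant is the absolute error of [local_limit] divided by the main term $2\pi/\sqrt{2\pi
   ns}$, with $s \le 1 + M_0$. The threshold 2 is the condition [(1 < n)%N] of that lemma. *)
exists (K * Num.sqrt (2 * pi * (1 + M0)) / (2 * pi)), 2%N.
move=> n m n0 /[dup] /andP[amu mub] /Hz [x xab px] pdiv.
have nR0 : 0 < n%:R :> R by rewrite ltr0n.
have x0 : 0 < x by case/andP: xab => h _; apply: lt_le_trans h.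
exists x; split=> //.
  move=> z z0 pz; apply/eqP; case: ltgtP => // h.
    by have := phi_incr Dd1 Dd2 d12 z0 h; rewrite pz px ltxx.
  by have := phi_incr Dd1 Dd2 d12 x0 h; rewrite pz px ltxx.
move=> n2 _.
pose s := variance D x.
have s0 : 0 < s := variance_gt0 Dd1 Dd2 d12 x0.
have phi0b : 0 <= phi D x <= b.
  by rewrite px mub andbT divr_ge0.
have m4 B := prob_fourth_moment Dr al0 albe B phi0b xab.
have sM : s <= 1 + M0 by apply: (variance_le Dr x0) => B; exact: m4.
have cs : c <= s.
  apply: le_trans (variance_ge Dr x0 r).
  apply: (@le_trans _ _ (kap * (a - r%:R) ^+ 2)); first by rewrite ge_min lexx orbT.
  apply: ler_pM; rewrite ?(ltW kap0) ?sqr_ge0 //; first exact: Hkap.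
  rewrite -[leRHS]sqrrN opprB lerXn2r ?nnegrE ?(ltW ar0) //.
    by rewrite px subr_ge0 (le_trans (ltW r_lt_a)).
  by rewrite px lerD2r.
have f0 := SetD_gt0 Dr x0.
pose P B : {poly R} := \poly_(d < B) weight R D d.
pose A := ((P (2 * m).+1) ^+ n)`_(2 * m).
have kA := sum_kappa_coef R D n (ltnSn (2 * m)).
rewrite -/(P _) -/A in kA.
have C00 : (2 * m)`!%:R / (2 ^ m * m`!)%:R != 0 :> R.
  by rewrite mulf_neq0 ?invr_eq0 // pnatr_eq0 -lt0n ?muln_gt0 ?expn_gt0 fact_gt0.
(* The coefficient is independent of the truncation because the sum of the [kappa R G] is. *)
have AE B : (2 * m < B)%N -> ((P B) ^+ n)`_(2 * m) = A.
  by move=> hB; apply: (mulfI C00); rewrite -kA; exact/esym/sum_kappa_coef.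
(* The probability that [n] independent variables distributed as [prob D x] sum to [2 * m]. *)
pose X := A * x ^+ (2 * m) * (SetD D x)^-1 ^+ n.
have bound : `|2 * pi / p%:R * X - Num.sqrt (2 * pi / (n%:R * s))|
    <= K / n%:R * Num.sqrt n%:R^-1.
  (* With [n] and [m] fixed, the truncation error can be made arbitrarily small by enlarging [B],
     while [X] does not change. *)
  apply: (@le_of_le_add_eps _ _ _ (K * n%:R ^+ 2)).
    by rewrite mulr_ge0 ?sqr_ge0 // ltW.
  move=> e /andP[e0 e1].
  have [B] := prob_nearly_centered Dr (maxn B0 (2 * m).+1) x0 e0.
  rewrite geq_max => /andP[B0B mB] nc.
  have QE k : (\poly_(d < B) prob D x d)`_k = (P B)`_k * x ^+ k * (SetD D x)^-1.
    by rewrite !coef_poly; case: ltnP => // _; rewrite !mul0r.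
  have := HK (prob D x) B (phi D x) s e n (2 * m)%N (prob_ge0 Dr x0) nc
    (le_trans (m4 B) M0_le).
  rewrite cs sM (ltW e0) e1 => /(_ isT isT).
  rewrite (coef_scaled_exprn QE) AE //; apply => //.
  - move=> t tT; have [q1 _ _ _] := nc.
    apply: (le_trans (Hc1 _ B (phi D x) t B0B (prob_ge0 Dr x0) q1 _ tT)).
      by move=> d dB Dd; exact: Hkap.
    by rewrite lerD2l lerN2 ler_wpM2r ?sqr_ge0 // ge_min lexx.
  - by rewrite px mulrC divfK // gt_eqF.
  (* Exponents of the n-th power are congruent to [r * n] modulo [p], and so is [2 * m] by
     hypothesis. *)
  - move=> k kne; rewrite -[(p %| _)%N]/((p%:Z %| k%:Z - (2 * m)%:Z)%Z).
    have -> : k%:Z - (2 * m)%:Z =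
      (k%:Z - (r * n)%:Z) - ((2 * m)%:Z - (r * n)%:Z) by ring.
    rewrite rpredB //; apply: (coef_exprn_support _ kne) => d.
    rewrite coef_poly; case: ltnP => // _; rewrite ?eqxx // /prob /weight.
    case: (boolP (d \in D)) => [/set_mem Dd _|_]; last by rewrite !mul0r eqxx.
    by case: p_gcd => h _; exact: h.
pose q := Num.sqrt (2 * pi * n%:R * s).
have q0 : 0 < q by rewrite sqrtr_gt0 !mulr_gt0.
have qE : Num.sqrt (2 * pi / (n%:R * s)) = 2 * pi / q.
  apply: (mulIf (lt0r_neq0 q0)); rewrite divfK ?gt_eqF //.
  rewrite -sqrtrM ?divr_ge0 ?mulr_ge0 ?(ltW pi0) ?(ltW s0) //.
  rewrite [X in Num.sqrt X](_ : _ = (2 * pi) ^+ 2); last first.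
    by field; rewrite !gt_eqF.
  by rewrite sqrtr_sqr ger0_norm // mulr_ge0 // ltW.
(* Forced by $X = (p/q)(1 + \varepsilon)$. *)
exists (X * q / p%:R - 1); split.
  have -> : X * q / p%:R - 1 = (2 * pi / p%:R * X - 2 * pi / q) * (q / (2 * pi)).
    by move: tau0 q0; move: (2 * pi) (q) => tau w tau0 w0; field; rewrite !gt_eqF.
  rewrite normrM [X in _ * X]ger0_norm; last first.
    by rewrite divr_ge0 // ltW.
  rewrite qE in bound.
  apply: (@le_trans _ _ (K / n%:R * Num.sqrt n%:R^-1 * (q / (2 * pi)))).
    by rewrite ler_wpM2r // divr_ge0 // ltW.
  have nq : Num.sqrt n%:R^-1 * q = Num.sqrt (2 * pi * s).
    rewrite -sqrtrM ?invr_ge0 ?(ltW nR0) //; congr Num.sqrt.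
    by field; rewrite gt_eqF.
  have -> : K / n%:R * Num.sqrt n%:R^-1 * (q / (2 * pi)) =
    K / n%:R / (2 * pi) * (Num.sqrt n%:R^-1 * q) by ring.
  rewrite nq.
  have -> : K * Num.sqrt (2 * pi * (1 + M0)) / (2 * pi) / n%:R =
    K / n%:R / (2 * pi) * Num.sqrt (2 * pi * (1 + M0)) by ring.
  apply: ler_wpM2l.
    by rewrite !divr_ge0 // ltW.
  by rewrite ler_wsqrtr // ler_wpM2l // ltW.
rewrite kA /main_term.
have -> : 2 * pi * n%:R * x * derive1 (@phi R D) x = 2 * pi * n%:R * s.
  by rewrite -mulrA (derive1_phi Dr x0).
rewrite -/q /X exprVn.
have F0 : SetD D x ^+ n != 0 by rewrite expf_neq0 // gt_eqF.
have Y0 : x ^+ (2 * m) != 0 by rewrite expf_neq0 // gt_eqF.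
move: F0 Y0; set F := SetD D x ^+ n; set Y := x ^+ (2 * m) => F0 Y0.
rewrite -!mulrA; congr (_ * (_ * _)).
by field; rewrite F0 Y0 !gt_eqF.
Qed.
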